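(* Let $F=\{f_1<\cdots<f_k\}$ ($k\ge1$) be an admissible finite set of positive integers. Define the first order differential operators $$C_F=\frac{\tilde\Omega_F(x)}{\tilde\Omega_{F_\Downarrow}(x)}\partial-\frac{\tilde\Omega_F'(x)+2x\,\tilde\Omega_F(x)}{\tilde\Omega_{F_\Downarrow}(x)},\qquad E_F=-\frac{\tilde\Omega_{F_\Downarrow}(x)}{\tilde\Omega_F(x)}\partial+\frac{\tilde\Omega_{F_\Downarrow}'(x)}{\tilde\Omega_F(x)} .$$ Then $D_{F_\Downarrow}=E_FC_F+2(u_F-k-1)\,\mathrm{Id}$ and $D_F=C_FE_F+2u_F\,\mathrm{Id}$. Moreover, with $G=I(F)=\{g_1<\cdots<g_m\}$, for all $n\ge v_F$, $$C_F\big(H_{n-k-1}^{F_\Downarrow}\big)=\frac{-2^{\,m+\binom{k-s_F+2}{2}-\binom{k+1}{2}-1}\ \prod_{j=1}^{m-1}(g_m-g_j)}{\prod_{j=1}^{s_F-1}\Big[(j-1)!\,(j-n+u_F)\prod_{f\in F;\,f>s_F}(f-j)\Big]}\;H_n^F(x).$$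
   Context: $\partial=d/dx$. Identities between operators are identities of differential operators with rational coefficients. Hermite polynomials: $H_n(x)=n!\sum_{j=0}^{[n/2]}\frac{(-1)^j(2x)^{n-2j}}{j!(n-2j)!}$. For a finite set of positive integers $F=\{f_1<\cdots<f_k\}$: $u_F=\sum_{f\in F}f-\binom{k+1}{2}$; $v_F=\sum_{f\in F}f+f_k-\frac{(k-1)(k+2)}2=u_F+f_k+1$; $\sigma_F=\{u_F,u_F+1,\dots\}\setminus\{u_F+f: f\in F\}$; for $n\in\sigma_F$, $H_n^F(x)$ is the $(k+1)\times(k+1)$ determinant whose first row is $(H_{n-u_F}^{(j)}(x))_{j=0}^k$ and whose $(l+1)$-th row is $(H_{f_l}^{(j)}(x))_{j=0}^k$, $l=1,\dots,k$; $\Omega_F(x)=\det\big(H_{f_l}^{(j-1)}(x)\big)_{l,j=1}^k$; and $$D_F=-\partial^2+2\Big(x+\frac{\Omega_F'(x)}{\Omega_F(x)}\Big)\partial+2\Big(k+u_F-x\frac{\Omega_F'(x)}{\Omega_F(x)}\Big)-\frac{\Omega_F''(x)}{\Omega_F(x)} .$$ Involution: $I(F)=\{1,2,\dots,f_k\}\setminus\{f_k-f: f\in F\}$. Writing $G=I(F)=\{g_1<\cdots<g_m\}$, set $\tilde\Omega_F(x)=i^{u_G+m}\det\big(H_{g_l}^{(j-1)}(-ix)\big)_{l,j=1}^m$, where $i=\sqrt{-1}$, $u_G=\sum_{g\in G}g-\binom{m+1}2$, and $H_g^{(j)}(-ix)$ is the $j$-th derivative of $H_g$ evaluated at $-ix$.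 $s_F=k+1$ if $F=\{1,2,\dots,k\}$, and $s_F=\min\{s\ge1: s<f_s\}$ otherwise. $F_\Downarrow=\emptyset$ if $F=\{1,\dots,k\}$, and $F_\Downarrow=\{f_{s_F}-s_F,\dots,f_k-s_F\}$ otherwise. Conventions for the empty set: $u_\emptyset=0$, $\sigma_\emptyset=\{0,1,2,\dots\}$, $\Omega_\emptyset=\tilde\Omega_\emptyset=1$, $H_n^\emptyset=H_n$, $D_\emptyset=-\partial^2+2x\partial$. Empty products equal $1$. Admissible: write $F=\bigcup_{i=1}^KY_i$ as a disjoint union where the elements of each $Y_i$ are consecutive integers and $1+\max Y_i<\min Y_{i+1}$ for $i=1,\dots,K-1$. $F$ is admissible if every $Y_i$ has an even number of elements. *)

(* Defs.v *)
From mathcomp Require Import all_boot all_order all_algebra.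
From mathcomp Require Import fraction generic_quotient ring.

Set Implicit Arguments.
Unset Strict Implicit.
Unset Printing Implicit Defensive.

Import Order.TTheory GRing.Theory Num.Theory.
Local Open Scope ring_scope.

(* A finite set F = {f_1 < ... < f_k} is given by the list of its elements in
   increasing order, so that f_(i+1) = nth 0 F i and k = size F. *)
Definition posset (F : seq nat) : Prop := sorted ltn F /\ 0%N \notin F.

(* F is the union of blocks Y_1, ..., Y_K of consecutive integers with
   1 + max Y_i < min Y_(i+1), all of even cardinality. *)
Definition admissible (F : seq nat) : Prop :=
  exists Y : seq (seq nat),
    [/\ F = flatten Y,
        forall B, B \in Y -> B <> [::] /\ B = iota (head 0%N B) (size B),
        sorted (fun A B => (last 0%N A).+1 < head 0%N B)%N Y
      & forall B, B \in Y -> ~~ odd (size B)].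

Definition fmax (F : seq nat) : nat := last 0%N F.

(* The subtraction is not truncated on a set of positive integers, where
   f_j >= j. *)
Definition uF (F : seq nat) : nat := (sumn F - 'C((size F).+1, 2))%N.

Definition vF (F : seq nat) : nat := (uF F + fmax F).+1.

Definition involF (F : seq nat) : seq nat :=
  [seq j <- iota 1 (fmax F) | j \notin [seq fmax F - f | f <- F]%N].

(* Here find returns s - 1. *)
Definition sF (F : seq nat) : nat :=
  if F == iota 1 (size F) then (size F).+1
  else (find (fun i => i.+1 < nth 0 F i)%N (iota 0 (size F))).+1.

Definition downF (F : seq nat) : seq nat :=
  if F == iota 1 (size F) then [::]
  else [seq (f - sF F)%N | f <- drop (sF F).-1 F].

Section Polynomials.
Variable C : numClosedFieldType.

Definition hermite (n : nat) : {poly C} :=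
  \sum_(j < (n./2).+1)
    (n`!%:R * (-1) ^+ j / (j`!%:R * (n - j.*2)`!%:R)) *:
    (2%:R *: 'X) ^+ (n - j.*2).

Definition wronskian (s : seq {poly C}) : {poly C} :=
  \det (\matrix_(l < size s, j < size s) (s`_l)^`(j)).

Definition OmegaF (F : seq nat) : {poly C} :=
  wronskian [seq hermite f | f <- F].

(* Meaningful for n in sigma_F; in particular n >= u_F. *)
Definition hermiteF (F : seq nat) (n : nat) : {poly C} :=
  wronskian [seq hermite f | f <- (n - uF F)%N :: F].

(* The entries are the derivatives of H_g evaluated at - i x, not the
   derivatives of x |-> H_g (- i x). *)
Definition tOmegaF (F : seq nat) : {poly C} :=
  let G := involF F in
  'i ^+ (uF G + size G) *:
    \det (\matrix_(l < size G, j < size G)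
            ((hermite (nth 0%N G l))^`(j) \Po (- 'i *: 'X))).

End Polynomials.

Notation "{ 'ratfun' C }" := {fraction {poly C}}
  (at level 0, format "{ 'ratfun'  C }") : type_scope.
Notation "p %:F" := (tofrac p) : ring_scope.

Section Operators.
Variable C : numClosedFieldType.

Local Notation K := {ratfun C}.

(* The quotient rule on a representative; see fderiv_frac. *)
Definition fderiv (y : K) : K :=
  let r := repr y in
  ((\n_r)^`() * \d_r - \n_r * (\d_r)^`())%:F / (\d_r ^+ 2)%:F.

Lemma frac_numden (r : {ratio {poly C}}) :
  \pi_K%qT r = (\n_r)%:F / (\d_r)%:F.
Proof.
have d0 := denom_ratioP r.
change (\pi_(FracField.type _)%qT r =
  FracField.mul (tofrac \n_r) (FracField.inv (tofrac \d_r))).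
rewrite !piE; apply/eqmodP => /=.
rewrite FracField.equivfE /FracField.mulf /FracField.invf.
by rewrite !numden_Ratio ?mulf_neq0 ?oner_neq0 // mul1r mulr1 mulrC.
Qed.

Lemma fderiv_frac (p q : {poly C}) : q != 0 ->
  fderiv (p%:F / q%:F) = (p^`() * q - p * q^`())%:F / (q ^+ 2)%:F.
Proof.
move=> q0; set y := _ / _; set r := repr y.
have d0 : \d_r != 0 by exact: denom_ratioP.
have yE : y = (\n_r)%:F / (\d_r)%:F.
  by rewrite -[LHS]reprK frac_numden.
have e : p * \d_r = \n_r * q.
  apply/eqP; rewrite -tofrac_eq !rmorphM /= -eqr_div ?tofrac_eq0 //.
  by rewrite -yE.
have e' : p^`() * \d_r + p * (\d_r)^`() = (\n_r)^`() * q + \n_r * q^`().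
  by rewrite -!derivM e.
rewrite /fderiv -/r; apply/eqP.
rewrite eqr_div ?tofrac_eq0 ?expf_neq0 // -!rmorphM /= tofrac_eq.
apply/eqP.
have -> : ((\n_r)^`() * \d_r - \n_r * (\d_r)^`()) * q ^+ 2 =
  ((\n_r)^`() * q) * (\d_r * q) - (\n_r * q) * ((\d_r)^`() * q) by ring.
have -> : (\n_r)^`() * q = p^`() * \d_r + p * (\d_r)^`() - \n_r * q^`().
  by rewrite e' addrK.
rewrite mulrBl.
have -> : \n_r * q^`() * (\d_r * q) = \n_r * q * (q^`() * \d_r) by ring.
by rewrite -e; ring.
Qed.

(* An operator is the map it induces on rational functions; as C has
   characteristic 0, this map determines the coefficients. *)
Definition opD (F : seq nat) (y : K) : K :=
  let x : K := 'X%:F in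
  let O : K := (OmegaF C F)%:F in
  let O' := (OmegaF C F)^`()%:F in
  let O'' := (OmegaF C F)^`(2)%:F in
  - fderiv (fderiv y) + 2%:R * (x + O' / O) * fderiv y
  + (2%:R * ((size F)%:R + (uF F)%:R - x * (O' / O)) - O'' / O) * y.

Definition opC (F : seq nat) (y : K) : K :=
  let x : K := 'X%:F in
  let T : K := (tOmegaF C F)%:F in
  let T' := (tOmegaF C F)^`()%:F in
  let S := (tOmegaF C (downF F))%:F in
  T / S * fderiv y - (T' + 2%:R * x * T) / S * y.

Definition opE (F : seq nat) (y : K) : K :=
  let T : K := (tOmegaF C F)%:F in
  let S := (tOmegaF C (downF F))%:F in
  let S' := (tOmegaF C (downF F))^`()%:F in
  - (S / T) * fderiv y + S' / T * y.

End Operators.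

(* Main.v *)
(* The operators factor by one Hirota bilinear identity.  If h_1, ..., h_(m+1)
   solve h'' + p h' = l_j h, iterated Darboux transformations turn
   the quotient of T = Wr(h_1, ..., h_(m+1)) by S = Wr(h_1, ..., h_m) into an
   eigenfunction of d^2 + p d + m p' + 2 (log S)'', that is
     T''S - 2T'S' + TS'' + p (T'S - TS') = (l_(m+1) - m p') TS.
   Since I(F_down) is I(F) without its maximum, this applies (after x -> -ix) to
   T = tOmega_F and S = tOmega_(F_down).  It also applies to Omega_F and
   Wr(H_0, H_F), which is proportional to Omega_(F_down).  For a given S the
   identity has at most one rational solution T up to a constant, so Omega_F and
   tOmega_F are proportional by induction on F; both factorizations follow.
   Finally C_F(H^(F_down)_(n-k-1)) and H^F_n are rational eigenfunctions of D_F
   with eigenvalue 2n, hence proportional, and the constant is the ratio of their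
   leading coefficients, which are Vandermonde products. *)
Require Import Defs.
From mathcomp Require Import all_boot all_order all_algebra.
From mathcomp Require Import perm fraction ring zify.

Set Implicit Arguments.
Unset Strict Implicit.
Unset Printing Implicit Defensive.

Import Order.TTheory GRing.Theory Num.Theory.
Local Open Scope ring_scope.

(** * Hermite polynomials: coefficients, derivative, differential equation *)

Section Hermite.
Variable C : numClosedFieldType.

Local Notation H := (hermite C).

Let fact_neq0 n : n`!%:R != 0 :> C.
Proof. by rewrite pnatr_eq0 -lt0n fact_gt0. Qed.

Lemma coef_hermite_even i j :
  (H (i + j.*2)%N)`_i = (i + j.*2)`!%:R * (-1) ^+ j / (j`!%:R * i`!%:R) * 2%:R ^+ i.
Proof.
have lt : (j < ((i + j.*2)./2).+1)%N by lia.
rewrite /hermite coef_sum (bigD1 (Ordinal lt)) //= big1 ?addr0 => [|j' ne].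
  by rewrite addnK exprZn !coefZ coefXn eqxx mulr1.
rewrite exprZn !coefZ coefXn.
suff /negPf-> : i != (i + j.*2 - j'.*2)%N by rewrite !mulr0.
have := ltn_ord j'; move/eqP: ne => ne lt'; apply/eqP => e; apply: ne.
by apply: val_inj => /=; lia.
Qed.

Lemma coef_hermite_odd n i : (forall j, n != i + j.*2)%N -> (H n)`_i = 0.
Proof.
move=> ne; rewrite /hermite coef_sum big1 // => j _.
rewrite exprZn !coefZ coefXn; have := ltn_ord j; have := ne j => /eqP nej ltj.
suff /negPf-> : i != (n - j.*2)%N by rewrite !mulr0.
by apply/eqP => e; apply: nej; lia.
Qed.

Lemma hermite_parity n i :
  ({j | n = i + j.*2} + {forall j, n != i + j.*2})%N%type.
Proof.
case e : ((i <= n) && ~~ odd (n - i))%N; [left | right].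
  by exists (n - i)./2; case/andP: e; lia.
by move=> j; apply/eqP => e'; move: e; rewrite e' addKn odd_double leq_addr.
Qed.

Lemma deriv_hermite n : (H n.+1)^`() = (n.+1.*2)%:R *: H n.
Proof.
apply/polyP => i; rewrite coef_deriv coefZ.
case: (hermite_parity n i) => [[j ->]|ne]; last first.
  by rewrite !coef_hermite_odd ?mul0rn ?mulr0 // => j; have := ne j; lia.
rewrite -addSn !coef_hermite_even addSn !factS -[(_.+1).*2%N]mul2n !natrM exprS.
rewrite -[X in X = _]mulr_natr.
have := fact_neq0 j; have := fact_neq0 i.
have : i.+1%:R != 0 :> C by rewrite pnatr_eq0.
by move: (i.+1%:R) j`!%:R i`!%:R ((i + j.*2)%N.+1%:R) => a b c d a0 b0 c0; field; apply/and3P.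
Qed.

Lemma hermite_ode n : (H n)^`(2) - 2%:R *: ('X * (H n)^`()) = - (2%:R * n%:R) *: H n.
Proof.
apply/polyP => i; rewrite coefB !coefZ !coef_deriv.
have -> : ('X * (H n)^`())`_i = (H n)`_i *+ i.
  by rewrite coefXM; case: i => [|i] //=; rewrite coef_deriv.
case: (hermite_parity n i) => [[j ->]|ne]; last first.
  rewrite (@coef_hermite_odd n i) // coef_hermite_odd => [|j].
    by rewrite !mul0rn !mulr0 subr0.
  by have := ne j.+1; lia.
(* For [j = 0] the index [i] is the degree and the second derivative contributes nothing; otherwise
   its contribution is computed in [c2]. *)
case: j => [|j].
  rewrite addn0 (@coef_hermite_odd i i.+2) => [|j]; last by lia.
  by rewrite !mul0rn sub0r -[_ *+ i]mulr_natr; ring.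
have c2 : (H (i + j.+1.*2)%N)`_i.+2 =
    (i + j.+1.*2)`!%:R * (-1) ^+ j / (j`!%:R * i.+2`!%:R) * 2%:R ^+ i.+2.
  have -> : (i + j.+1.*2 = i.+2 + j.*2)%N by lia.
  exact: coef_hermite_even.
have NE : (i + j.+1.*2)%:R = i%:R + 2%:R * j.+1%:R :> C.
  by rewrite natrD -muln2 natrM mulrC.
rewrite c2 coef_hermite_even -[_ *+ i.+2]mulr_natr -[_ *+ i.+1]mulr_natr -[_ *+ i]mulr_natr.
rewrite NE !factS !natrM !exprS.
have := fact_neq0 j; have := fact_neq0 i; move: ((i + j.+1.*2)`!%:R : C) (_ ^+ i) (_ ^+ j).
have : j.+1%:R != 0 :> C by rewrite pnatr_eq0.
have : i.+1%:R != 0 :> C by rewrite pnatr_eq0.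
have : i.+2%:R != 0 :> C by rewrite pnatr_eq0.
rewrite -[i.+2]add2n -[i.+1]add1n -[j.+1]add1n !natrD.
move: (i%:R : C) (j%:R : C) (j`!%:R : C) (i`!%:R : C) => a a' b c a0 b0 c0 x y z d0 e0.
by field; rewrite a0 b0 c0 d0 e0.
Qed.

Lemma size_hermite_le n : (size (H n) <= n.+1)%N.
Proof.
apply/leq_sizeP => j lt; apply: coef_hermite_odd => i; apply/eqP; lia.
Qed.

Lemma coef_hermite_top n : (H n)`_n = 2%:R ^+ n.
Proof.
rewrite -[X in H X](addn0 n) -[0%N]/(0.*2)%N coef_hermite_even.
by rewrite addn0 expr0 mulr1 mul1r divff ?mul1r.
Qed.

Lemma hermite0 : H 0 = 1.
Proof. by rewrite (size1_polyC (size_hermite_le 0)) coef_hermite_top. Qed.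

End Hermite.

(** * Darboux transformations and Wronskians over a field with a derivation *)

Section Darboux.
Variables (K : fieldType) (d : K -> K).
Hypothesis dD : {morph d : x y / x + y}.
Hypothesis dM : forall x y, d (x * y) = d x * y + x * d y.

Let d0 : d 0 = 0.
Proof. by apply: (addIr (d 0)); rewrite add0r -dD addr0. Qed.

Let dN x : d (- x) = - d x.
Proof. by apply/eqP; rewrite -addr_eq0 -dD addNr d0. Qed.

Let dB x y : d (x - y) = d x - d y.
Proof. by rewrite dD dN. Qed.

Let d1 : d 1 = 0.
Proof. by have := dM 1 1; rewrite !mulr1 mul1r => e; apply: (addIr (d 1)); rewrite add0r. Qed.

Let dV x : x != 0 -> d x^-1 = - d x / x ^+ 2.
Proof.
move=> x0; have := dM x x^-1; rewrite divff // d1 => /eqP.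
rewrite eq_sym addrC addr_eq0 => /eqP e; apply: (mulfI x0); rewrite e.
by field.
Qed.

Let d2 : d 2%:R = 0.
Proof. by rewrite -[2%:R]/(1 + 1) dD d1 addr0. Qed.

Section Factorization.
Variables (x T S k : K).
Hypotheses (dx : d x = 1) (T0 : T != 0) (S0 : S != 0).
Hypothesis TS : d (d T) * S - 2%:R * d T * d S + T * d (d S)
  + 2%:R * x * (d T * S - T * d S) = 2%:R * k * T * S.

Local Notation C y := (T / S * d y - (d T + 2%:R * x * T) / S * y).
Local Notation E y := (- (S / T) * d y + d S / T * y).
Local Notation D l V y := (- d (d y) + 2%:R * (x + d V / V) * d y
  + (2%:R * (l - x * (d V / V)) - d (d V) / V) * y).

(** [TS] solved for the second derivative of [T]; substituting it turns the next three lemmas into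
    identities of rational expressions. *)
Let ddT : d (d T) = (2%:R * k * T * S + 2%:R * d T * d S - T * d (d S)
  - 2%:R * x * (d T * S - T * d S)) / S.
Proof. by rewrite -TS; field. Qed.

Lemma factor_EC u y : D u S y = E (C y) + 2%:R * (u - k - 1) * y.
Proof.
by rewrite !(dB, dM, dD, dV, d2, dx) // ddT; field; rewrite S0 T0.
Qed.

Lemma factor_CE u y : D (k + u) T y = C (E y) + 2%:R * u * y.
Proof.
by rewrite !(dD, dM, dN, dV, dB) // ddT; field; rewrite S0 T0.
Qed.

(** Here [T] defines the operator and [S] is the eigenfunction; it serves with [T] = Omega_F and [S]
    = H_n^F. *)
Lemma eigen_hirota u : D u T S = 2%:R * (u - k) * S.
Proof. by rewrite ddT; field; rewrite S0 T0. Qed.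

(** Abel's formula: the zeroth order terms, eigenvalue included, cancel in the derivative of the
    Wronskian. *)
Lemma eigen_Wronskian l u V y z : D u V y = l * y -> D u V z = l * z ->
  d (y * d z - d y * z) = 2%:R * (x + d V / V) * (y * d z - d y * z).
Proof.
move=> ey ez.
have ddy : d (d y) = 2%:R * (x + d V / V) * d y
    + (2%:R * (u - x * (d V / V)) - d (d V) / V) * y - l * y by rewrite -ey; ring.
have ddz : d (d z) = 2%:R * (x + d V / V) * d z
    + (2%:R * (u - x * (d V / V)) - d (d V) / V) * z - l * z by rewrite -ez; ring.
by rewrite dB !dM ddy ddz; ring.
Qed.

End Factorization.

Variable h : nat -> K.

(* The seed of the [m]-th Darboux step is the image of [h m] under the previous ones. *)
Fixpoint dtrans m y : K :=
  if m is m'.+1 then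
    d (dtrans m' y) - d (dtrans m' (h m')) / dtrans m' (h m') * dtrans m' y
  else y.

Local Notation tau m := (dtrans m (h m)).

Definition Wr m : K := \det (\matrix_(l < m, j < m) iter j d (h l)).

(** Linear differential operators of order below [m]: adding one to [iter m d] in the last column of
    a Wronskian of size [m + 1] does not change the determinant. *)
Definition lowop m (f : K -> K) :=
  exists c : nat -> K, forall y, f y = \sum_(j < m) c j * iter j d y.

Lemma lowopS m f : lowop m f -> lowop m.+1 f.
Proof.
case=> c cE; exists (fun j => if (j < m)%N then c j else 0) => y.
rewrite big_ord_recr /= ltnn mul0r addr0 cE.
by apply: eq_bigr => j _; rewrite ltn_ord.
Qed.

Lemma lowopD m f g : lowop m f -> lowop m g -> lowop m (fun y => f y + g y).
Proof.
move=> [c cE] [e eE]; exists (fun j => c j + e j) => y.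
by rewrite cE eE -big_split; apply: eq_bigr => j _ /=; rewrite mulrDl.
Qed.

Lemma lowopZ m a f : lowop m f -> lowop m (fun y => a * f y).
Proof.
move=> [c cE]; exists (fun j => a * c j) => y.
by rewrite cE mulr_sumr; apply: eq_bigr => j _; rewrite mulrA.
Qed.

Lemma lowop_iter m : lowop m.+1 (iter m d).
Proof.
exists (fun j => (j == m)%:R) => y.
rewrite big_ord_recr /= eqxx mul1r big1 ?add0r // => j _.
by rewrite (ltn_eqF (ltn_ord j)) mul0r.
Qed.

Lemma lowop_d m f : lowop m f -> lowop m.+1 (fun y => d (f y)).
Proof.
move=> [c cE].
have [e eE] : lowop m.+1 (fun y => \sum_(j < m) d (c j) * iter j d y).
  by apply: lowopS; exists (fun j => d (c j)).
exists (fun j => e j + (if j is j'.+1 then c j' else 0)) => y.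
rewrite cE (big_morph d dD d0).
under eq_bigr do rewrite dM.
rewrite big_split /= eE; under [RHS]eq_bigr do rewrite mulrDl.
by rewrite big_split /= [X in _ = _ + X]big_ord_recl mul0r add0r.
Qed.

Lemma dtransE m : lowop m (fun y => dtrans m y - iter m d y).
Proof.
elim: m => [|m IH]; first by exists (fun=> 0) => y; rewrite big_ord0 subrr.
set w := d (tau m) / tau m.
have := lowopD (lowop_d IH) (lowopD (lowopZ (- w) (lowop_iter m)) (lowopZ (- w) (lowopS IH))).
case=> c cE; exists c => y; rewrite -cE /= -/w dB; ring.
Qed.

Lemma dtrans_eq0 m l : (forall i, (i < m)%N -> tau i != 0) -> (l < m)%N ->
  dtrans m (h l) = 0.
Proof.
elim: m => // m IH nz; rewrite ltnS leq_eqVlt => /orP[/eqP->|lt] /=.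
  by rewrite divfK ?subrr // nz.
by rewrite IH ?d0 ?mulr0 ?subrr // => i ltim; apply: nz; apply: leqW.
Qed.

(** Crum's formula. By [dtransE], column operations replace the last column by the values
    [dtrans m (h i)]; these vanish for [i < m], which leaves one cofactor. *)
Lemma WrS m : (forall i, (i < m)%N -> tau i != 0) -> Wr m.+1 = Wr m * tau m.
Proof.
move=> nz; rewrite {1}/Wr; set A := \matrix_(l, j) _.
have [c cE] := dtransE m.
have AE (i j : 'I_m.+1) : A i j = iter j d (h i) by rewrite mxE.
(* Pairing another column with the cofactors of the last one expands a determinant with two equal
   columns. *)
have orth (j : 'I_m.+1) : j != ord_max -> \sum_i A i j * cofactor A i ord_max = 0.
  move=> ne; transitivity ((\adj A *m A) ord_max j); last first.
    by rewrite mul_adj_mx mxE eq_sym (negPf ne) mulr0n.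
  by rewrite mxE; apply: eq_bigr => i _; rewrite [in RHS]mxE mulrC.
rewrite (expand_det_col _ ord_max).
transitivity (\sum_(i : 'I_m.+1) (dtrans m (h i)) * cofactor A i ord_max).
  have e (i : 'I_m.+1) : A i ord_max = dtrans m (h i) - \sum_(j < m) c j * iter j d (h i).
    by rewrite -cE AE; ring.
  under eq_bigr do rewrite e mulrBl mulr_suml.
  rewrite sumrB exchange_big /= [X in _ - X]big1 ?subr0 // => j _.
  have := orth (widen_ord (leqnSn m) j).
  rewrite -val_eqE /= (ltn_eqF (ltn_ord j)) => /(_ isT) o.
  rewrite -[RHS](mulr0 (c j)) -[X in _ = _ * X]o mulr_sumr; apply: eq_bigr => i _.
  by rewrite AE mulrA.
rewrite big_ord_recr /= big1 ?add0r => [|i _]; last first.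
  by rewrite dtrans_eq0 ?mul0r //= ltn_ord.
rewrite mulrC; congr (_ * _).
rewrite /cofactor -signr_odd oddD addbb mul1r /Wr; congr (\det _).
apply/matrixP => i j; rewrite !mxE; congr (iter _ d (h _)).
  by rewrite /= /bump leqNgt ltn_ord.
by rewrite /= /bump leqNgt ltn_ord.
Qed.

Lemma Wr0 : Wr 0 = 1.
Proof. exact: det_mx00. Qed.

Lemma tau_neq0 m : (forall i, (i <= m)%N -> Wr i != 0) ->
  forall i, (i < m)%N -> tau i != 0.
Proof.
elim: m => // m IH nz i; rewrite ltnS leq_eqVlt => /orP[/eqP->|lt].
  have := nz m.+1 (leqnn _); rewrite WrS.
    by rewrite mulf_eq0 => /norP[].
  by apply: IH => i' le; apply: nz; apply: leqW.
by apply: IH => // i' le; apply: nz; apply: leqW.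
Qed.

Variable p : K.

Local Notation L b y := (d (d y) + p * d y + b * y).

(** The logarithmic derivative [w] of [t] obeys a Riccati equation, which makes [d - w] intertwine
    the two operators; the summand [d p] comes from commuting [d] with [p]. *)
Lemma darboux b t l l' y (w := d t / t) : t != 0 -> d l = 0 -> d l' = 0 ->
  L b t = l * t -> L b y = l' * y ->
  L (b + d p + 2%:R * d w) (d y - w * y) = l' * (d y - w * y).
Proof.
move=> t0 dl dl' Lt Ly.
have dw : d w = l - p * w - b - w ^+ 2.
  have ddt : d (d t) = l * t - p * d t - b * t by rewrite -Lt; ring.
  by rewrite /w dM dV // ddt; field.
have ddw : d (d w) = - d p * w - p * d w - d b - 2%:R * w * d w.
  by rewrite {1}dw expr2 !dB !dM dl; ring.
have ddy : d (d y) = l' * y - p * d y - b * y by rewrite -Ly; ring.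
have dddy : d (d (d y)) = l' * d y - d p * d y - p * d (d y) - d b * y - b * d y.
  by rewrite {1}ddy !dB !dM dl'; ring.
(* [w] becomes a free symbol: its Riccati equation and the derivative of that equation suffice. *)
move: w dw ddw => v dv ddv.
by rewrite !dB !dM !dD !dM ddv dddy ddy dv; ring.
Qed.

Variable lam : nat -> K.
Hypothesis dlam : forall i, d (lam i) = 0.
Hypothesis hP : forall i, L 0 (h i) = lam i * h i.

(** [Wr m] is the product of the seeds [tau i], so the potentials added along the chain sum up to
    one logarithmic derivative. *)
Lemma dlog_Wr m : (forall i, (i <= m)%N -> Wr i != 0) ->
  \sum_(i < m) d (tau i) / tau i = d (Wr m) / Wr m.
Proof.
elim: m => [|m IH] nz; first by rewrite big_ord0 Wr0 d1 mul0r.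
have S0 := nz m (leqnSn _); have t0 := tau_neq0 nz (leqnn _).
rewrite big_ord_recr /= IH => [|i le]; last by apply: nz; apply: leqW.
rewrite WrS ?dM; first by field; rewrite S0 t0.
by apply: tau_neq0 => i le; apply: nz; apply: leqW.
Qed.

Lemma dtrans_eigen m l y : (forall i, (i <= m)%N -> Wr i != 0) -> d l = 0 ->
  L 0 y = l * y ->
  L (m%:R * d p + 2%:R * d (d (Wr m) / Wr m)) (dtrans m y) = l * dtrans m y.
Proof.
move=> nz dl Ly; rewrite -dlog_Wr //.
elim: m l y nz dl Ly => [|m IH] l y nz dl Ly.
  by rewrite big_ord0 d0 mul0r mulr0 addr0.
have nz' i : (i <= m)%N -> Wr i != 0 by move=> le; apply: nz; apply: leqW.
have t0 := tau_neq0 nz (leqnn _).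
have := darboux t0 (dlam m) dl (IH _ _ nz' (dlam m) (hP m)) (IH _ _ nz' dl Ly).
rewrite big_ord_recr /= => <-; congr (_ + _ * _).
by rewrite -[m.+1]addn1 natrD dD; ring.
Qed.

(** Write [T = S * tau m] and multiply the eigenvalue equation of [tau m] by [S ^+ 2]. *)
Lemma Wr_hirota m (T := Wr m.+1) (S := Wr m) : (forall i, (i <= m)%N -> Wr i != 0) ->
  d (d T) * S - 2%:R * d T * d S + T * d (d S) + p * (d T * S - T * d S)
  + m%:R * d p * T * S = lam m * T * S.
Proof.
move=> nz; have S0 : S != 0 := nz m (leqnn _).
have E := dtrans_eigen nz (dlam m) (hP m).
have -> : T = S * tau m by apply: WrS; apply: tau_neq0.
move: (tau m) E; rewrite -/S => t E.
have dv : d (d S / S) = d (d S) / S - (d S / S) ^+ 2.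
  by rewrite dM dV //; field.
have : S ^+ 2 * (L (m%:R * d p + 2%:R * d (d S / S)) t) = S ^+ 2 * (lam m * t).
  by rewrite E.
rewrite dv => {}E.
transitivity (S ^+ 2 * (lam m * t)); last by ring.
by rewrite -E !dM !dD !dM; field.
Qed.

End Darboux.

(** * Degrees and leading coefficients of Wronskians of Hermite polynomials *)

Section LeadingCoefficient.
Variable C : numClosedFieldType.

Local Notation H := (hermite C).

(** The Vandermonde product, by recursion on the list so that it splits along concatenations. *)
Fixpoint vdm (a : seq nat) : C :=
  if a is x :: a' then (\prod_(y <- a') (y%:R - x%:R)) * vdm a' else 1.

Lemma vdm_cat a b :
  vdm (a ++ b) = vdm a * vdm b * \prod_(x <- a) \prod_(y <- b) (y%:R - x%:R).
Proof.
elim: a => [|x a IH] /=; first by rewrite big_nil mulr1 mul1r.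
by rewrite big_cons big_cat /= IH; ring.
Qed.

Lemma vdm_rcons a y : vdm (rcons a y) = vdm a * \prod_(x <- a) (y%:R - x%:R).
Proof.
rewrite -cats1 vdm_cat /= big_nil !mulr1; congr (_ * _).
by apply: eq_bigr => x _; rewrite big_seq1.
Qed.

Lemma vdm_neq0 a : uniq a -> vdm a != 0.
Proof.
elim: a => [|x a IH] /=; first by rewrite oner_neq0.
case/andP=> xa ua; rewrite mulf_neq0 ?IH // prodf_seq_neq0.
apply/allP => y ya; rewrite /= subr_eq0 eqr_nat.
by apply: contraNneq xa => <-.
Qed.

Lemma vdmE a :
  \prod_(i < size a) \prod_(j < size a | (i < j)%N)
    ((nth 0%N a j)%:R - (nth 0%N a i)%:R) = vdm a.
Proof.
elim: a => [|x a IH]; first by rewrite big_ord0.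
rewrite /= big_ord_recl big_mkcond big_ord_recl /= mul1r; congr (_ * _).
  by rewrite (big_nth 0%N) big_mkord.
rewrite -IH; apply: eq_bigr => i _.
rewrite big_mkcond big_ord_recl /= mul1r -big_mkcond.
by apply: eq_big => j.
Qed.

(** The falling factorial [n ^_ j] is a monic polynomial of degree [j] in [n], so the matrix is a
    Vandermonde matrix times a unitriangular one. *)
Lemma det_ffact a :
  \det (\matrix_(l < size a, j < size a) (nth 0%N a l ^_ j)%:R) = vdm a.
Proof.
pose P j : {poly C} := \prod_(i < j) ('X - i%:R%:P).
have PE j n : (P j).[n%:R] = (n ^_ j)%:R.
  elim: j => [|j IH]; first by rewrite /P big_ord0 hornerC.
  rewrite /P big_ord_recr hornerM IH ffactnSr natrM !hornerE /=.
  (* The difference [n - j] is truncated for [n < j], but then its cofactor [n ^_ j] is zero. *)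
  case: (leqP j n) => [le|lt]; first by rewrite natrB.
  by rewrite ffact_small // !mul0r.
have Pmonic j : P j \is monic by apply: monic_prod => i _; apply: monicXsubC.
have sizeP j : size (P j) = j.+1.
  by rewrite /P size_prod_XsubC /index_enum -enumT size_enum_ord.
pose r : 'rV[C]_(size a) := \row_j (nth 0%N a j)%:R.
pose U : 'M[C]_(size a) := \matrix_(j, i) (P j)`_i.
have -> : (\matrix_(l < size a, j < size a) (nth 0%N a l ^_ j)%:R) =
    (U *m Vandermonde (size a) r)^T.
  apply/matrixP => l j; rewrite !mxE -PE horner_coef sizeP.
  rewrite (big_ord_widen _ (fun i => (P j)`_i * (nth 0%N a l)%:R ^+ i) (ltn_ord j)).
  rewrite big_mkcond; apply: eq_bigr => i _; rewrite !mxE.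
  by case: ltnP => // lt; rewrite nth_default ?mul0r // sizeP.
rewrite det_tr det_mulmx det_Vandermonde det_trig; last first.
  by apply/is_trig_mxP => i j lt; rewrite mxE nth_default // sizeP.
rewrite big1 => [|i _]; last first.
  by rewrite mxE; have /monicP := Pmonic i; rewrite lead_coefE sizeP.
rewrite mul1r -vdmE; apply: eq_bigr => i _; apply: eq_bigr => j _.
by rewrite !mxE.
Qed.

Lemma coef_top_mul (p q : {poly C}) m n : (size p <= m.+1)%N -> (size q <= n.+1)%N ->
  (size (p * q)%R <= (m + n).+1)%N /\ (p * q)`_(m + n) = p`_m * q`_n.
Proof.
move=> sp sq; split.
  by apply: leq_trans (size_polyMleq _ _) _; lia.
have lt : (m < (m + n).+1)%N by lia.
rewrite coefM (bigD1 (Ordinal lt)) //= big1 ?addr0 ?addKn // => i ne.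
have : (i : nat) != m by apply: contraNneq ne => e; apply/eqP/val_inj.
rewrite neq_ltn => /orP[lti|lti].
  by rewrite [q`_ _]nth_default ?mulr0 //; apply: leq_trans sq _; lia.
by rewrite nth_default ?mul0r //; apply: leq_trans sp _.
Qed.

Lemma coef_top_prod m (n : 'I_m -> nat) (p : 'I_m -> {poly C}) :
  (forall i, size (p i) <= (n i).+1)%N ->
  (size (\prod_i p i)%R <= (\sum_i n i).+1)%N /\
  (\prod_i p i)`_(\sum_i n i)%N = \prod_i (p i)`_(n i).
Proof.
move=> sp.
apply: (big_rec3 (fun (n : nat) (c : C) (p : {poly C}) =>
   (size p <= n.+1)%N /\ p`_n = c)) => [|i c q k _ [sq qc]].
  by rewrite size_poly1 coef1.
by have [s1 s2] := coef_top_mul (sp i) sq; rewrite s2 qc.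
Qed.

(** Multiplying column [j] by ['X ^+ j] makes up for the degree lost in [j] derivations; the
    exponents add up to the binomial coefficient. *)
Lemma wronskian_mulXn (s : seq {poly C}) :
  'X ^+ 'C(size s, 2) * wronskian s =
  \det (\matrix_(l < size s, j < size s) ('X ^+ j * (s`_l)^`(j))).
Proof.
pose D : 'rV[{poly C}]_(size s) := \row_j 'X ^+ j.
transitivity (\det (\matrix_(l < size s, j < size s) (s`_l)^`(j) *m diag_mx D)).
  rewrite det_mulmx mulrC det_diag; congr (_ * _).
  under eq_bigr do rewrite mxE.
  by rewrite -[RHS]/(\prod_(i < size s) 'X ^+ (id i)) -expr_sum -bin2_sum big_mkord.
by congr (\det _); rewrite mul_mx_diag; apply/matrixP => l j; rewrite !mxE mulrC.
Qed.

Definition lead_wr (a : seq nat) : C := 2%:R ^+ sumn a * vdm a.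

(** After this multiplication every entry of row [l] has degree at most a_l, with coefficient
    2^(a_l) times a falling factorial there. Hence the coefficient of degree [sumn a] is the
    determinant of [det_ffact] up to a power of 2. *)
Lemma wronskian_hermite_top a (W := 'X ^+ 'C(size a, 2) * wronskian [seq H i | i <- a]) :
  (size W <= (sumn a).+1)%N /\ W`_(sumn a) = lead_wr a.
Proof.
rewrite /W -(size_map H a) wronskian_mulXn size_map.
have sumE : sumn a = (\sum_(i < size a) nth 0 a i)%N.
  by rewrite sumnE (big_nth 0%N) big_mkord.
pose B (l j : 'I_(size a)) : {poly C} := 'X ^+ j * (H (nth 0%N a l))^`(j).
have BE : \matrix_(l < size a, j < size a) ('X ^+ j * ([seq H i | i <- a]`_l)^`(j))
    = \matrix_(l, j) B l j.
  by apply/matrixP => l j; rewrite !mxE (nth_map 0%N).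
have sB l j : (size (B l j) <= (nth 0 a l).+1)%N.
  apply/leq_sizeP => i lt; rewrite /B coefXnM; case: ltnP => // le.
  rewrite coef_derivn subnKC // nth_default ?mul0rn //.
  exact: leq_trans (size_hermite_le _ _) lt.
have cB l j : (B l j)`_(nth 0%N a l) = 2%:R ^+ (nth 0%N a l) * (nth 0%N a l ^_ j)%:R.
  rewrite /B coefXnM; case: ltnP => [lt|le]; first by rewrite ffact_small // mulr0.
  by rewrite coef_derivn subnKC // coef_hermite_top mulr_natr.
rewrite BE /determinant.
under eq_bigr => s _ do under eq_bigr => i _ do rewrite mxE.
have top (s : 'S_(size a)) := coef_top_prod (fun l => sB l (s l)).
rewrite sumE; split.
  apply: leq_trans (size_sum _ _ _) _; apply/bigmax_leqP => s _.
  by have [le _] := top s; rewrite mulr_sign; case: ifP; rewrite ?size_polyN.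
rewrite /lead_wr -det_ffact coef_sum /determinant mulr_sumr.
apply: eq_bigr => s _.
transitivity ((-1) ^+ s * (\prod_l B l (s l))`_(\sum_(i < size a) nth 0 a i)%N).
  by rewrite !mulr_sign; case: ifP; rewrite ?coefN.
have [_ ->] := top s; rewrite mulrCA; congr (_ * _).
under [in RHS]eq_bigr do rewrite mxE.
by rewrite sumE expr_sum -big_split; apply: eq_bigr => l _; apply: cB.
Qed.

Lemma lead_wr_neq0 a : uniq a -> lead_wr a != 0.
Proof. by move=> ua; rewrite mulf_neq0 ?vdm_neq0 // expf_neq0 ?pnatr_eq0. Qed.

Lemma size_wronskian_hermite_aux a : uniq a ->
  size ('X ^+ 'C(size a, 2) * wronskian [seq H i | i <- a]) = (sumn a).+1.
Proof.
move=> ua; have [le c] := wronskian_hermite_top a.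
apply/eqP; rewrite eqn_leq le ltnNge; apply/negP => le'.
by have := lead_wr_neq0 ua; rewrite -c nth_default ?eqxx.
Qed.

Lemma wronskian_hermite_neq0 a : uniq a -> wronskian [seq H i | i <- a] != 0.
Proof.
move=> ua; have := size_wronskian_hermite_aux ua; apply: contra_eq_neq => ->.
by rewrite mulr0 size_poly0.
Qed.

Lemma lead_coef_wronskian_hermite a : uniq a ->
  lead_coef (wronskian [seq H i | i <- a]) = lead_wr a.
Proof.
move=> ua; have [_ <-] := wronskian_hermite_top a.
by rewrite -(lead_coef_monicM _ (monicXn C 'C(size a, 2))) lead_coefE size_wronskian_hermite_aux.
Qed.

Lemma size_wronskian_hermite a : uniq a ->
  (size (wronskian [seq H i | i <- a]) + 'C(size a, 2))%N = (sumn a).+1.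
Proof.
move=> ua; rewrite -size_wronskian_hermite_aux // mulrC.
by rewrite size_mulXn ?wronskian_hermite_neq0 // addnC.
Qed.

End LeadingCoefficient.

(** * Rational functions, and the bilinear identity for polynomials *)

Lemma quotient_ruleD (K : fieldType) (p q r s p' q' r' s' : K) : q != 0 -> s != 0 ->
  ((p' * s + p * s' + (r' * q + r * q')) * (q * s) - (p * s + r * q) * (q' * s + q * s'))
    / (q * s * (q * s))
  = (p' * q - p * q') / (q * q) + (r' * s - r * s') / (s * s).
Proof. by move=> q0 s0; field; rewrite q0 s0. Qed.

Lemma quotient_ruleM (K : fieldType) (p q r s p' q' r' s' : K) : q != 0 -> s != 0 ->
  ((p' * r + p * r') * (q * s) - p * r * (q' * s + q * s')) / (q * s * (q * s))
  = (p' * q - p * q') / (q * q) * (r / s) + p / q * ((r' * s - r * s') / (s * s)).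
Proof. by move=> q0 s0; field; rewrite q0 s0. Qed.

Section RationalFunctions.
Variable C : numClosedFieldType.

Local Notation K := {ratfun C}.

Lemma ratfunP (y : K) : exists p q : {poly C}, q != 0 /\ y = p%:F / q%:F.
Proof.
exists \n_(repr y), \d_(repr y); split; first exact: denom_ratioP.
by rewrite -[LHS]reprK frac_numden.
Qed.

Lemma fderiv_tofrac (p : {poly C}) : fderiv p%:F = p^`()%:F.
Proof.
have := fderiv_frac p (oner_neq0 {poly C}).
by rewrite tofrac1 divr1 expr1n tofrac1 divr1 -polyC1 derivC mulr0 subr0 mulr1.
Qed.

Lemma fderivD : {morph @fderiv C : y z / y + z}.
Proof.
move=> y z; have [p [q [q0 ->]]] := ratfunP y; have [r [s [s0 ->]]] := ratfunP z.
have [q0' s0'] : q%:F != 0 /\ s%:F != 0 by rewrite !tofrac_eq0.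
have -> : p%:F / q%:F + r%:F / s%:F = (p * s + r * q)%:F / (q * s)%:F.
  by rewrite (addf_div _ _ q0' s0') tofracD !tofracM.
rewrite (fderiv_frac p q0) (fderiv_frac r s0) (fderiv_frac _ (mulf_neq0 q0 s0)).
rewrite derivD !derivM !(tofracB, tofracD, tofracM, tofracXn).
move: q0' s0'; move: p%:F q%:F r%:F s%:F p^`()%:F q^`()%:F r^`()%:F s^`()%:F.
exact: quotient_ruleD.
Qed.

Lemma fderivM (y z : K) : fderiv (y * z) = fderiv y * z + y * fderiv z.
Proof.
have [p [q [q0 ->]]] := ratfunP y; have [r [s [s0 ->]]] := ratfunP z.
have [q0' s0'] : q%:F != 0 /\ s%:F != 0 by rewrite !tofrac_eq0.
have -> : p%:F / q%:F * (r%:F / s%:F) = (p * r)%:F / (q * s)%:F.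
  by rewrite (mulf_div p%:F) !tofracM.
rewrite (fderiv_frac p q0) (fderiv_frac r s0) (fderiv_frac _ (mulf_neq0 q0 s0)).
rewrite !derivM !(tofracB, tofracD, tofracM, tofracXn).
move: q0' s0'; move: p%:F q%:F r%:F s%:F p^`()%:F q^`()%:F r^`()%:F s^`()%:F.
exact: quotient_ruleM.
Qed.

Lemma iter_fderiv j (p : {poly C}) : iter j (@fderiv C) p%:F = p^`(j)%:F.
Proof. by elim: j => [|j IH] //=; rewrite IH fderiv_tofrac. Qed.

Lemma wronskianE n (s : seq {poly C}) : size s = n ->
  wronskian s = \det (\matrix_(l < n, j < n) (s`_l)^`(j)).
Proof. by move=> <-. Qed.

Lemma wronskian_Wr m (s : seq {poly C}) : (m <= size s)%N ->
  Wr (@fderiv C) (fun l => (s`_l)%:F) m = (wronskian (take m s))%:F.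
Proof.
move=> le; rewrite (@wronskianE m) ?size_takel // /Wr -det_map_mx.
by congr (\det _); apply/matrixP => l j; rewrite !mxE iter_fderiv nth_take.
Qed.

Lemma wronskian_perm (s t : seq {poly C}) : perm_eq s t ->
  exists b : bool, wronskian s = (-1) ^+ b * wronskian t.
Proof.
move=> /[dup] /perm_size e /(@tuple_permP _ _ _ (in_tuple t)) [p sE].
exists p; rewrite (wronskianE e) -det_perm -det_mulmx -row_permE.
congr (\det _); apply/matrixP => l j; rewrite !mxE sE.
by rewrite (nth_map l) ?size_enum_ord // nth_ord_enum (tnth_nth 0).
Qed.

Lemma wronskian_1cons (s : seq {poly C}) :
  wronskian (1 :: s) = wronskian [seq p^`() | p <- s].
Proof.
rewrite (wronskianE (size_map _ s)) /wronskian (expand_det_row _ ord0).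
rewrite big_ord_recl !mxE mul1r big1 ?addr0 => [|j _]; last first.
  by rewrite mxE lift0 derivSn -polyC1 derivC linear0 mul0r.
rewrite /cofactor mul1r; congr (\det _); apply/matrixP => l j.
by rewrite !mxE /= (nth_map 0) // -derivSn.
Qed.

(** The bilinear identity with [p = 2x]; the constant [c] absorbs both the eigenvalue and the
    derivative of [p]. *)
Definition hirota (c : C) (T S : {poly C}) :=
  T^`(2) * S - 2%:R * T^`() * S^`() + T * S^`(2)
  + 2%:R * 'X * (T^`() * S - T * S^`()) = c%:P * T * S.

Lemma hirotaZ c a b T S : hirota c T S -> hirota c (a *: T) (b *: S).
Proof.
rewrite /hirota !derivnS !derivn0 => E; rewrite !derivZ.
transitivity ((a * b) *: (c%:P * T * S)); last first.
  by rewrite -!mul_polyC polyCM; ring.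
by rewrite -E -!mul_polyC polyCM; ring.
Qed.

(** Under x -> -ix the second order terms change sign and the term in 2x does not. A global sign
    change restores the former, and exchanging [T] and [S] the latter. *)
Lemma hirota_comp_im c T S (r := - 'i *: 'X : {poly C}) :
  hirota c T S -> hirota (- c) (S \Po r) (T \Po r).
Proof.
rewrite /hirota !derivnS !derivn0 => E.
have dr : r^`() = - 'i%:P by rewrite derivZ derivX -mul_polyC polyCN mulr1.
have i2 : ('i%:P * 'i%:P : {poly C}) = -1 by rewrite -polyCM -expr2 sqrCi polyCN.
have rE : r = - 'i%:P * 'X by rewrite /r -mul_polyC polyCN.
have two : (2%:R \Po r) = 2%:R :> {poly C} by rewrite -polyC_natr comp_polyC.
have {}E := congr1 (fun p => p \Po r) E; move: E.
rewrite /= !(two, comp_polyB, comp_polyD, comp_polyM, comp_polyC, comp_polyX).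
rewrite !deriv_comp dr !derivM !deriv_comp dr !derivN !derivC oppr0 mulr0 !addr0.
rewrite polyCN; move: (T \Po r) (S \Po r) (T^`() \Po r) (S^`() \Po r).
move: (T^`()^`() \Po r) (S^`()^`() \Po r) => t'' s'' t s t' s'.
rewrite rE => E; apply: (etrans (y := - (c%:P * t * s))); last by ring.
by rewrite -E; ring: i2.
Qed.

Lemma mulX_eq0 (u v : {poly C}) : 'X * u = v -> (size v <= size u)%N -> u = 0.
Proof.
move=> <-; apply: contraTeq => u0.
by rewrite mulrC size_mulX // ltnn.
Qed.

Lemma size_deriv_mul (p q : {poly C}) : (size (p^`() * q)%R <= size (p * q)%R)%N.
Proof.
have [->|p0] := eqVneq p 0; first by rewrite linear0 !mul0r.
have [->|q0] := eqVneq q 0; first by rewrite !mulr0.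
rewrite (size_mul p0 q0); apply: leq_trans (size_polyMleq _ _) _.
by rewrite -!subn1 leq_sub2r // leq_add2r ltnW // lt_size_deriv.
Qed.

(** If [a] is nonzero, comparing the coefficients of degree deg a + deg b in X a' b = X a b' gives
    deg a = deg b. *)
Lemma deriv_prop_size (a b : {poly C}) : a^`() * b = a * b^`() ->
  b != 0 -> size a != size b -> a = 0.
Proof.
move=> E b0; apply: contraNeq => a0.
have [m sa] : exists m, size a = m.+1.
  by exists (size a).-1; rewrite prednK // size_poly_gt0.
have [n sb] : exists n, size b = n.+1.
  by exists (size b).-1; rewrite prednK // size_poly_gt0.
have Xd (p : {poly C}) i : ('X * p^`())`_i = p`_i *+ i.
  by rewrite coefXM; case: i => [|i] //=; rewrite coef_deriv.
have sXd (p : {poly C}) i : (size p <= i.+1 -> size ('X * p^`())%R <= i.+1)%N.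
  move=> le; apply/leq_sizeP => j lt; rewrite Xd nth_default ?mul0rn //.
  exact: leq_trans le lt.
have [_ c1] := coef_top_mul (sXd _ _ (eq_leq sa)) (eq_leq sb).
have [_ c2] := coef_top_mul (eq_leq sa) (sXd _ _ (eq_leq sb)).
have : a`_m * b`_n != 0.
  have -> : a`_m = lead_coef a by rewrite lead_coefE sa.
  have -> : b`_n = lead_coef b by rewrite lead_coefE sb.
  by rewrite mulf_neq0 ?lead_coef_eq0.
move: c2; rewrite mulrCA -E mulrA c1 !Xd mulrnAl mulrnAr -!(mulr_natl (_ * _)) => e nz.
by have := mulIf nz e => /eqP; rewrite eqr_nat sa sb eqSS.
Qed.

(** The combination of [a] and [b] that cancels the leading terms solves the same equation against
    [b] but has smaller degree, hence vanishes. *)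
Lemma deriv_prop (a b : {poly C}) : a^`() * b = a * b^`() -> a != 0 -> b != 0 ->
  lead_coef b *: a = lead_coef a *: b.
Proof.
move=> E a0 b0.
have [sz|ne] := eqVneq (size a) (size b); last first.
  by have := deriv_prop_size E b0 ne; move/eqP: a0.
apply/eqP; rewrite -subr_eq0; apply/eqP/(deriv_prop_size _ b0).
  by rewrite derivB !derivZ -!mul_polyC; ring: E.
have [n sb] : exists n, size b = n.+1.
  by exists (size b).-1; rewrite prednK // size_poly_gt0.
rewrite neq_ltn; apply/orP; left; rewrite sb ltnS.
apply/leq_sizeP => j; rewrite leq_eqVlt => /orP[/eqP<-|lt].
  by rewrite coefB !coefZ !lead_coefE sz sb mulrC subrr.
by rewrite coefB !coefZ !nth_default ?mulr0 ?subrr ?sz ?sb.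
Qed.

(* The Wronskian of two solutions [T] would be a multiple of [S ^ 2 exp (- x ^ 2)],
   hence vanishes. *)
Lemma hirota_uniq c T T' S : hirota c T S -> hirota c T' S ->
  S != 0 -> T != 0 -> T' != 0 -> lead_coef T' *: T = lead_coef T *: T'.
Proof.
rewrite /hirota !derivnS !derivn0 => E E' S0 T0 T0'.
apply: deriv_prop => //; apply/eqP; rewrite -subr_eq0; apply/eqP.
set w := _ - _.
have dw : w^`() = T^`()^`() * T' - T * T'^`()^`() by rewrite derivB !derivM; ring.
suff /eqP : S * w = 0 by rewrite mulf_eq0 (negPf S0) => /eqP.
(* Eliminating [c] between the two identities gives 2 X S w = 2 S' w - S w', where no product on the
   right exceeds the degree of S w. *)
apply: (@mulX_eq0 _ ((2%:R^-1)%:P * (2%:R * S^`() * w - S * w^`()))).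
  have two : (2%:R^-1)%:P * 2%:R = 1 :> {poly C}.
    by rewrite -polyC_natr -polyCM mulVf ?pnatr_eq0.
  rewrite -[LHS]mul1r -[X in X * _ = _]two -[LHS]mulrA; congr (_ * _).
  apply/eqP; rewrite -subr_eq0; apply/eqP; rewrite dw /w.
  have := congr1 (fun p => p * T') E; have := congr1 (fun p => p * T) E' => /= e' e.
  apply: (etrans (y := (c%:P * T * S * T' - c%:P * T' * S * T))); last by ring.
  by rewrite -e -e'; ring.
rewrite mul_polyC; apply: leq_trans (size_scale_leq _ _) _.
apply: leq_trans (size_polyD _ _) _; rewrite size_polyN geq_max.
rewrite -mulrA -polyC_natr mul_polyC (leq_trans (size_scale_leq _ _)) ?size_deriv_mul //.
by rewrite mulrC [X in (_ <= size (polyseq X))%N]mulrC size_deriv_mul.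
Qed.

End RationalFunctions.

(** Hermite polynomials come with [p = -2x]; exchanging [T] and [S] restores the sign in [hirota],
    and the derivative of [p] joins the eigenvalue in [c]. *)
Lemma hirota_flip (R : comPzRingType) (c l m X T T1 T2 S S1 S2 : R) : c = 2%:R * m + l ->
  T2 * S - 2%:R * T1 * S1 + T * S2 + - (2%:R * X) * (T1 * S - T * S1)
    + m * - 2%:R * T * S = l * T * S ->
  S2 * T - 2%:R * S1 * T1 + S * T2 + 2%:R * X * (S1 * T - S * T1) = c * S * T.
Proof.
move=> -> E; transitivity (2%:R * m * S * T + l * T * S); last by ring.
by rewrite -E; ring.
Qed.

(** * Bilinear identity and index shift for Wronskians of Hermite polynomials *)

Section HermiteWronskians.
Variable C : numClosedFieldType.

Local Notation H := (hermite C).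
Local Notation W a := (wronskian [seq H i | i <- a]).

Lemma hermite_hirota a N : uniq a ->
  hirota (2%:R * ((size a)%:R - N%:R)) (W a) (W (rcons a N)).
Proof.
move=> ua; set s := [seq H i | i <- rcons a N].
have sz : size s = (size a).+1 by rewrite size_map size_rcons.
pose n i := nth 0%N (rcons a N) i.
pose h i := (s`_i)%:F : {ratfun C}.
pose lam i := (- (2%:R * (n i)%:R))%:P%:F : {ratfun C}.
pose p := (- (2%:R * 'X))%:F : {ratfun C}.
have dp : fderiv p = (- 2%:R)%:F.
  rewrite /p fderiv_tofrac derivN derivM derivX mulr1.
  by rewrite -polyC_natr derivC mul0r add0r.
have dlam i : fderiv (lam i) = 0 by rewrite fderiv_tofrac derivC tofrac0.
have hP i : fderiv (fderiv (h i)) + p * fderiv (h i) + 0 * h i = lam i * h i.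
  rewrite mul0r addr0 /h !fderiv_tofrac -!tofracM -tofracD; congr (_%:F).
  (* [h] is an infinite family; beyond the list its default value 0 solves the equation too. *)
  have [le|lt] := leqP (size s) i.
    by rewrite nth_default // !linear0 !mulr0 addr0.
  rewrite /s (nth_map 0%N) -?(size_map H) // -/(n i) mul_polyC.
  rewrite -hermite_ode derivnS derivn1 -polyC_natr mul_polyC mulNr scalerAl.
  by [].
have WE m : (m <= (size a).+1)%N -> Wr (@fderiv C) h m = (wronskian (take m s))%:F.
  by rewrite -sz; apply: wronskian_Wr.
have Wa i : (i <= size a)%N -> wronskian (take i s) = W (take i a).
  move=> le; rewrite /s map_rcons -cats1 takel_cat ?size_map //.
  by rewrite map_take.
have nz i : (i <= size a)%N -> Wr (@fderiv C) h i != 0.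
  move=> le; rewrite WE ?(leqW le) // Wa // tofrac_eq0.
  by rewrite wronskian_hermite_neq0 // take_uniq.
have := Wr_hirota (@fderivD C) (@fderivM C) dlam hP nz.
rewrite !WE // (Wa _ (leqnn _)) take_size take_oversize ?sz // dp /p /lam.
have -> : n (size a) = N by rewrite /n nth_rcons ltnn eqxx.
rewrite /hirota !derivnS !derivn0 !fderiv_tofrac => E.
apply/eqP; rewrite -tofrac_eq; apply/eqP.
have c2 : 2%:R%:F = 2%:R :> {ratfun C} by rewrite tofracMn tofrac1.
move: E; rewrite !(c2, tofracB, tofracD, tofracM, tofracN); move: (wronskian s) (W a) => T S.
have : (2%:R * ((size a)%:R - N%:R))%:P%:F =
    2%:R * (size a)%:R + (- (2%:R * N%:R))%:P%:F :> {ratfun C}.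
  rewrite mulrBr polyCB tofracB polyCM !polyC_natr tofracM c2 tofracMn tofrac1.
  by rewrite polyCN tofracN.
move: (T^`()^`()%:F) (S^`()^`()%:F) (T^`()%:F) (S^`()%:F) (T%:F) (S%:F) ('X%:F).
move: ((- (2%:R * N%:R))%:P%:F) ((2%:R * ((size a)%:R - N%:R))%:P%:F).
move=> l c T2 S2 T1 S1 T0 S0 X; exact: hirota_flip.
Qed.

Lemma wronskian_deriv_hermite a : 0%N \notin a ->
  wronskian [seq p^`() | p <- [seq H i | i <- a]] =
  (\prod_(i <- a) (i.*2)%:R) *: W [seq i.-1 | i <- a].
Proof.
move=> a0; rewrite (@wronskianE _ (size a)) ?size_map //.
rewrite [in RHS](@wronskianE _ (size a)) ?size_map //.
pose D : 'rV[{poly C}]_(size a) := \row_i ((nth 0%N a i).*2)%:R%:P.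
rewrite -mul_polyC (big_nth 0%N) big_mkord rmorph_prod /=.
transitivity (\det (diag_mx D *m
    \matrix_(l < size a, j < size a) ([seq H i | i <- [seq i.-1 | i <- a]]`_l)^`(j))).
  congr (\det _); rewrite mul_diag_mx; apply/matrixP => l j; rewrite !mxE.
  rewrite !(nth_map 0) ?(nth_map 0%N) ?size_map //.
  have := mem_nth 0%N (ltn_ord l); case: (nth _ _ _) => [e|f _].
    by rewrite e in a0.
  by rewrite deriv_hermite derivnZ mul_polyC.
rewrite det_mulmx det_diag; congr (_ * _).
by apply: eq_bigr => i _; rewrite mxE.
Qed.

(** Since H_0 = 1 and H_i' = 2i H_(i-1), deleting H_0 lowers the other indices by one; [t] deletions
    remove the block 0, ..., t-1. *)
Lemma wronskian_hermite_shift t R : all (leq t) R ->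
  exists2 c : C, c != 0 & W (iota 0 t ++ R) = c *: W [seq (f - t)%N | f <- R].
Proof.
elim: t R => [|t IH] R tR.
  exists 1; first exact: oner_neq0.
  by rewrite scale1r (eq_map (g := id)) ?map_id // => f; rewrite subn0.
have [|c c0 cE] := IH [seq f.-1 | f <- R].
  by rewrite all_map; apply: sub_all tR => f /=; lia.
have nz : 0%N \notin iota 1 t ++ R.
  by rewrite mem_cat mem_iota /=; apply/negP => /(allP tR).
exists (\prod_(i <- iota 1 t ++ R) (i.*2)%:R * c).
  rewrite mulf_neq0 // prodf_seq_neq0; apply/allP => i ia /=.
  by rewrite pnatr_eq0 double_eq0; apply/eqP => i0; rewrite i0 (negPf nz) in ia.
rewrite /= hermite0 wronskian_1cons wronskian_deriv_hermite // -scalerA.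
congr (_ *: _); rewrite map_cat (iotaDl 1 0) -map_comp (eq_map (g := id)) ?map_id //.
rewrite cE; congr (_ *: W _); rewrite -map_comp; apply: eq_map => f /=; lia.
Qed.

End HermiteWronskians.

(** * Combinatorics of F, F_down and I(F) *)

Lemma posset_path F : posset F <-> path ltn 0 F.
Proof.
rewrite (path_sortedE ltn_trans) /posset.
split=> [[s n0]|/andP[/allP n0 s]]; last by split=> //; apply/negP => /n0.
rewrite s andbT; apply/allP => x xF; rewrite lt0n.
by apply: contraNneq n0 => <-.
Qed.

Lemma path_ltn_decomp b F : path ltn b F -> exists t R,
  [/\ F = iota b.+1 t ++ R, all (ltn (b + t).+1) R & sorted ltn R].
Proof.
elim: F b => [|x F IH] b; first by exists 0%N, [::].
rewrite /= => /andP[bx xF]; have [e|ne] := eqVneq x b.+1.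
  have [t [R [FE allR sR]]] := IH _ xF.
  by exists t.+1, R; split; rewrite //= -?e ?FE // addnS -addSn -e.
exists 0%N, (x :: F); rewrite addn0; split=> //=.
have lt : (b.+1 < x)%N by lia.
rewrite lt; apply: sub_all (order_path_min ltn_trans xF) => y /=; lia.
Qed.

Lemma find_head_gt t r R : (t.+1 < r)%N ->
  find (fun i => i.+1 < nth 0 (iota 1 t ++ r :: R) i)%N
    (iota 0 (size (iota 1 t ++ r :: R))) = t.
Proof.
move=> lt; rewrite size_cat size_iota iotaD find_cat.
rewrite (_ : has _ (iota 0 t) = false) /=; last first.
  apply/hasPn => i; rewrite mem_iota /= => ltit.
  by rewrite nth_cat size_iota ltit nth_iota // add1n ltnn.
by rewrite add0n nth_cat !size_iota ltnn subnn /= lt addn0.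
Qed.

Lemma cat_neq_iota t r R n : (t.+1 < r)%N -> iota 1 t ++ r :: R <> iota 1 n.
Proof.
move=> lt e; have := congr1 size e; rewrite size_cat !size_iota /= => nE.
have ltn : (t < n)%N by lia.
have := congr1 (nth 0%N ^~ t) e.
by rewrite nth_cat size_iota ltnn subnn nth_iota //=; lia.
Qed.

(** Splitting off the maximal initial run 1, ..., t unifies the two cases in the definitions of s_F
    and F_down: [R] is empty when [F] is such a run. *)
Lemma posset_decomp F : posset F -> exists t R,
  [/\ F = iota 1 t ++ R, all (ltn t.+1) R, sorted ltn R,
      sF F = t.+1 & downF F = [seq (f - t.+1)%N | f <- R]].
Proof.
move/posset_path/path_ltn_decomp => [t [R [FE allR sR]]]; exists t, R.
suff sE : sF F = t.+1.
  split=> //; rewrite /downF sE /=; case: eqP => [e|_]; last first.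
    by rewrite FE drop_size_cat // size_iota.
  case: R FE allR sR => [|r R] // FE /= /andP[lt _] _.
  by move: e; rewrite {1}FE => /cat_neq_iota-/(_ lt).
rewrite /sF; case: R FE allR sR => [|r R] FE allR sR.
  by rewrite cats0 in FE; rewrite FE size_iota eqxx.
have lt : (t.+1 < r)%N by case/andP: allR.
by rewrite FE find_head_gt //; case: eqP => // /cat_neq_iota-/(_ lt).
Qed.

Lemma posset_subn t R : all (ltn t) R -> sorted ltn R ->
  posset [seq (f - t)%N | f <- R].
Proof.
move=> allR sR; split; last by apply/mapP => -[f /(allP allR) /=]; lia.
apply: (homo_sorted_in (P := ltn t)) allR sR => x y; rewrite !inE /=; lia.
Qed.

Lemma bin2D t r : 'C((t + r).+1, 2) = ('C(t.+1, 2) + 'C(r.+1, 2) + t * r)%N.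
Proof.
elim: r => [|r IH]; first by rewrite addn0 muln0 !addn0.
by rewrite addnS binS bin1 IH ['C(r.+2, 2)]binS bin1; lia.
Qed.

Lemma sumn_iota1 t : sumn (iota 1 t) = 'C(t.+1, 2).
Proof.
elim: t => // t IH; rewrite -{1}(addn1 t) iotaD sumn_cat IH /= ['C(t.+2, 2)]binS bin1; lia.
Qed.

Lemma uFK F : posset F -> (uF F + 'C((size F).+1, 2))%N = sumn F.
Proof.
move/posset_path => pF; rewrite subnK //.
(* The j-th element is at least [b + j]; a variable bound [b] lets the induction pass to the
   tail. *)
have gen b : path ltn b F -> (size F * b + 'C((size F).+1, 2) <= sumn F)%N.
  elim: F b {pF} => //= x F IH b /andP[bx] /IH.
  by rewrite ['C((size F).+2, 2)]binS bin1; nia.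
by have := gen 0%N pF; rewrite muln0.
Qed.

Lemma posset_involF F : posset (involF F).
Proof.
split; last by rewrite mem_filter mem_iota andbF.
by apply: (sorted_filter ltn_trans); apply: iota_ltn_sorted.
Qed.

Lemma sumn_map_subn s R : all (leq s) R ->
  (sumn [seq (f - s)%N | f <- R] + s * size R)%N = sumn R.
Proof. by elim: R => [|f R IH] /=; [rewrite muln0 | case/andP=> le /IH; lia]. Qed.

Lemma uF_down F : posset F -> posset (downF F) ->
  uF F = (uF (downF F) + size (downF F))%N.
Proof.
move=> pF pD; have := uFK pF; have := uFK pD.
have [t [R [-> allR _ _ ->]]] := posset_decomp pF.
rewrite sumn_cat sumn_iota1 size_cat size_iota size_map bin2D => eD e.
have := sumn_map_subn (sub_all (fun f => @ltnW t.+1 f) allR); lia.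
Qed.

Lemma last_iota1 t : last 0%N (iota 1 t) = t.
Proof. by case: t => // t; rewrite -(addn1 t) iotaD last_cat /= addnC. Qed.

(** Reflected, the initial run 1, ..., t excludes the t integers just below max F, and the other
    elements exclude what F_down excludes below its own maximum. *)
Lemma involF_down F : posset F -> F <> [::] ->
  involF F = rcons (involF (downF F)) (fmax F).
Proof.
move=> /[dup] pF [_ F0] Fne; have [t [R [FE allR _ _ ->]]] := posset_decomp pF.
have M0 : (0 < fmax F)%N.
  rewrite lt0n; apply: contraNneq F0 => <-; rewrite /fmax.
  by case: F Fne {pF FE} => // x F _; rewrite /= mem_last.
have iE : iota 1 (fmax F) = iota 1 (fmax F).-1 ++ [:: fmax F].
  by rewrite -{1}(prednK M0) -(addn1 (fmax F).-1) iotaD /= add1n prednK.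
rewrite /involF iE filter_cat /=.
rewrite ifT; last first.
  apply/mapP => -[f fF]; have : f != 0%N by apply: contraNneq F0 => <-.
  lia.
rewrite cats1; congr (rcons _ _); case: R FE allR => [|r R] FE allR.
  have -> : fmax F = t by rewrite FE cats0 /fmax last_iota1.
  apply/eqP; rewrite -[_ == _]negbK -has_filter; apply/hasPn => j.
  rewrite mem_iota negbK FE cats0 => jt; apply/mapP.
  by exists (t - j)%N; rewrite ?mem_iota; lia.
pose M := last r R; have ME : fmax F = M by rewrite /fmax FE last_cat.
have ltM : (t.+1 < M)%N by apply: (allP allR); apply: mem_last.
have -> : fmax [seq (f - t.+1)%N | f <- r :: R] = (M - t.+1)%N.
  exact: (last_map (fun f => (f - t.+1)%N)).
have -> : (fmax F).-1 = (M - t.+1 + t)%N by lia.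
rewrite iotaD filter_cat [X in _ ++ X](_ : _ = [::]); last first.
  apply/eqP; rewrite -[_ == _]negbK -has_filter; apply/hasPn => j.
  rewrite mem_iota negbK ME FE => jt; apply/mapP.
  by exists (M - j)%N; rewrite ?mem_cat ?mem_iota; lia.
rewrite cats0; apply: eq_in_filter => j; rewrite mem_iota => jM; congr (~~ _).
rewrite ME FE; apply/mapP/mapP => -[f].
  rewrite mem_cat mem_iota => /orP[|fR]; first by lia.
  have ltf : (t.+1 < f)%N := allP allR _ fR; move=> jE.
  by exists (f - t.+1)%N; [apply/mapP; exists f | lia].
case/mapP => g gR -> jE; exists g; first by rewrite mem_cat gR orbT.
have ltg : (t.+1 < g)%N := allP allR _ gR.
lia.
Qed.

(** The extra unit is the reflection of max F, which is 0 and lies outside 1, ..., max F. *)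
Lemma size_involF F : posset F -> F <> [::] ->
  (fmax F).+1 = (size (involF F) + size F)%N.
Proof.
have [n] := ubnP (fmax F); elim: n F => // n IH F szF pF Fne.
rewrite involF_down // size_rcons.
have [t [R [FE allR sR _ DE]]] := posset_decomp pF; rewrite DE.
case: R FE allR sR DE => [|r R] FE allR sR DE.
  by rewrite FE cats0 /fmax last_iota1 size_iota.
have ltM : (t.+1 < fmax F)%N.
  by rewrite /fmax FE last_cat; apply: (allP allR); apply: mem_last.
have DM : fmax (downF F) = (fmax F - t.+1)%N.
  rewrite DE /fmax FE last_cat; exact: (last_map (fun f => (f - t.+1)%N)).
have szE : size F = (t + (size R).+1)%N by rewrite FE size_cat size_iota.
have lt : (fmax (downF F) < n)%N by rewrite DM; move: szF; lia.
have ne : [seq (f - t.+1)%N | f <- r :: R] <> [::] by [].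
have := IH _ lt; rewrite DM DE => /(_ (posset_subn allR sR) ne).
by rewrite size_map /= szE; lia.
Qed.

Lemma posset_uniq F : posset F -> uniq F.
Proof. by case=> sF _; apply: (sorted_uniq ltn_trans ltnn). Qed.

Lemma posset_down F : posset F -> posset (downF F).
Proof.
move=> pF; have [t [R [_ allR sR _ ->]]] := posset_decomp pF.
exact: posset_subn.
Qed.

(** * Proportionality of Omega_F and tOmega_F *)

Section Omega.
Variable C : numClosedFieldType.

Local Notation H := (hermite C).
Local Notation W a := (wronskian [seq H i | i <- a]).
Local Notation Om F := (OmegaF C F).
Local Notation tOm F := (tOmegaF C F).

Lemma tOmegaFE F (G := involF F) :
  tOm F = 'i ^+ (uF G + size G) *: (Om G \Po (- 'i *: 'X)).
Proof.
congr (_ *: _); rewrite /OmegaF (wronskianE (size_map _ _)) -det_map_mx.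
by congr (\det _); apply/matrixP => l j; rewrite !mxE (nth_map 0%N).
Qed.

(** Omega_G has degree u_G + |G|, so the normalizing power of i cancels the power of -i produced by
    the substitution. *)
Lemma lead_coef_tOmegaF F : lead_coef (tOm F) = lead_wr C (involF F).
Proof.
rewrite tOmegaFE; set G := involF F.
have pG : posset G := posset_involF F; have uG := posset_uniq pG.
have sX : size (- 'i *: 'X : {poly C}) = 2.
  by rewrite size_scale ?size_polyX // oppr_eq0 neq0Ci.
rewrite lead_coefZ lead_coef_comp ?sX // lead_coefZ lead_coefX mulr1.
have -> : (size (Om G)).-1 = (uF G + size G)%N.
  have e : (size (Om G) + 'C(size G, 2) = (sumn G).+1)%N := size_wronskian_hermite C uG.
  have := uFK pG; rewrite binS bin1; lia.
rewrite lead_coef_wronskian_hermite // mulrCA -exprMn mulrN -expr2 sqrCi opprK.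
by rewrite expr1n mulr1.
Qed.

Lemma tOmegaF_neq0 F : tOm F != 0.
Proof.
rewrite -lead_coef_eq0 lead_coef_tOmegaF lead_wr_neq0 //.
exact/posset_uniq/posset_involF.
Qed.

Lemma OmegaF_neq0 F : posset F -> Om F != 0.
Proof. by move/posset_uniq; apply: wronskian_hermite_neq0. Qed.

(** By [involF_down] the two Wronskians differ by the Hermite polynomial of index max F;
    [size_involF] evaluates the constant. *)
Lemma hirota_tOmegaF F : posset F -> F <> [::] ->
  hirota (2%:R * (size F)%:R) (tOm F) (tOm (downF F)).
Proof.
move=> pF Fne; rewrite !tOmegaFE; apply: hirotaZ.
have uD := posset_uniq (posset_involF (downF F)).
have cE : 2%:R * (size F)%:R =
    - (2%:R * ((size (involF (downF F)))%:R - (fmax F)%:R)) :> C.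
  have := size_involF pF Fne; rewrite (involF_down pF Fne) size_rcons => -[->].
  by rewrite natrD; ring.
rewrite cE (involF_down pF Fne).
exact: (hirota_comp_im (hermite_hirota C (fmax F) uD)).
Qed.

(** Adjoining H_0 to the family of F gives, up to order, the indices 0, ..., t and [R], which the
    index shift reduces to F_down. *)
Lemma hirota_OmegaF F : posset F ->
  hirota (2%:R * (size F)%:R) (Om F) (Om (downF F)).
Proof.
move=> pF; have [t [R [FE allR _ _ ->]]] := posset_decomp pF.
have [c c0 cE] := wronskian_hermite_shift C (sub_all (fun x => @ltnW t.+1 x) allR).
have perm : perm_eq [seq H i | i <- rcons F 0%N] [seq H i | i <- iota 0 t.+1 ++ R].
  by apply: perm_map; rewrite FE perm_rcons.
have [b bE] := wronskian_perm perm.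
have := hermite_hirota C 0 (posset_uniq pF); rewrite subr0 => h.
have nz : (-1) ^+ b * c != 0 by rewrite mulf_neq0 ?signr_eq0.
have := hirotaZ 1 ((-1) ^+ b * c)^-1 h; rewrite scale1r bE cE.
have -> : (-1) ^+ b * (c *: W [seq (f - t.+1)%N | f <- R]) =
    ((-1) ^+ b * c) *: W [seq (f - t.+1)%N | f <- R].
  by rewrite -!mul_polyC polyCM rmorph_sign mulrA.
by rewrite scalerA mulVf // scale1r.
Qed.

Lemma OmegaF_tOmegaF F : posset F -> exists2 c, c != 0 & Om F = c *: tOm F.
Proof.
have [n] := ubnP (size F + sumn F); elim: n F => // n IH F szF pF.
have [->|/eqP Fne] := eqVneq F [::].
  exists 1; rewrite ?oner_neq0 // scale1r tOmegaFE.
  have -> : involF [::] = [::] by [].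
  by rewrite /OmegaF /wronskian !det_mx00 rmorph1 scale1r.
have pD := posset_down pF.
have [|c c0 cE] := IH (downF F) _ pD.
  have [t [R [FE allR _ _ DE]]] := posset_decomp pF.
  move: szF; rewrite ltnS; apply: leq_trans.
  rewrite DE [in X in (_ < X)%N]FE size_cat size_iota size_map sumn_cat.
  have := sumn_map_subn (sub_all (fun f => @ltnW t.+1 f) allR).
  case: R allR FE {DE} => [|r R] allR FE /=; last by nia.
  by case: t FE {allR} => [|t] FE //=; rewrite FE in Fne.
(* After rescaling, Omega_F and tOmega_F satisfy the identity with the same second entry, tOmega of
   F_down. *)
have := hirota_OmegaF pF; rewrite cE => /(hirotaZ 1 c^-1).
rewrite scale1r scalerA mulVf // scale1r => hO.
have := hirota_uniq (hirota_tOmegaF pF Fne) hO (tOmegaF_neq0 _) (tOmegaF_neq0 _) (OmegaF_neq0 pF).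
set a := lead_coef (Om F); set b := lead_coef (tOm F) => E.
have b0 : b != 0 by rewrite lead_coef_eq0 tOmegaF_neq0.
exists (b^-1 * a); first by rewrite mulf_neq0 ?invr_eq0 // lead_coef_eq0 OmegaF_neq0.
by rewrite -scalerA E scalerA mulVf // scale1r.
Qed.

End Omega.

(** * The two factorizations *)

Section Operators.
Variable C : numClosedFieldType.

Local Notation K := {ratfun C}.
Local Notation d := (@fderiv C).
Local Notation Om F := (OmegaF C F).
Local Notation tOm F := (tOmegaF C F).
Local Notation x := ('X%:F : K).

Lemma fderivX : d x = 1.
Proof. by rewrite fderiv_tofrac derivX tofrac1. Qed.

Lemma tofrac_natr n : (n%:R : {poly C})%:F = n%:R :> K.
Proof. by rewrite tofracMn tofrac1. Qed.

Lemma hirota_ratfun (c : C) (k : K) (T S : {poly C}) :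
  hirota c T S -> c%:P%:F = 2%:R * k ->
  d (d T%:F) * S%:F - 2%:R * d T%:F * d S%:F + T%:F * d (d S%:F)
  + 2%:R * x * (d T%:F * S%:F - T%:F * d S%:F) = 2%:R * k * T%:F * S%:F.
Proof.
rewrite /hirota !derivnS !derivn0 => /(congr1 (fun p => p%:F)) E <-.
rewrite !fderiv_tofrac; move: E.
by rewrite !(tofrac_natr 2, tofracB, tofracD, tofracM).
Qed.

(** Omega_F enters only through O'/O and O''/O, so a proportional polynomial may replace it. *)
Lemma opD_scale F (c : C) (T : {poly C}) (u y : K) : c != 0 -> Om F = c *: T ->
  (size F)%:R + (uF F)%:R = u ->
  opD F y = - d (d y) + 2%:R * (x + d T%:F / T%:F) * d y
    + (2%:R * (u - x * (d T%:F / T%:F)) - d (d T%:F) / T%:F) * y.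
Proof.
move=> c0 OE <-; rewrite /opD OE derivnS derivn1 !derivZ !fderiv_tofrac.
have c0' : c%:P%:F != 0 :> K by rewrite tofrac_eq0 polyC_eq0.
have cE (p q : {poly C}) : (c *: p)%:F / (c *: q)%:F = p%:F / q%:F.
  by rewrite -!mul_polyC !tofracM -mulf_div divff // mul1r.
by rewrite !cE.
Qed.

Lemma opC_tofrac F (p : {poly C}) (T := tOm F) (S := tOm (downF F)) :
  opC F p%:F = (T * p^`() - (T^`() + 2%:R * 'X * T) * p)%:F / S%:F.
Proof.
rewrite /opC -/T -/S fderiv_tofrac.
rewrite !(tofrac_natr 2, tofracB, tofracD, tofracM).
move: (T%:F) (S%:F) (T^`()%:F) (p%:F) (p^`()%:F) ('X%:F) => a b a' e e' z.
by rewrite !mulrBl ![_ / b * _]mulrAC.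
Qed.

Lemma opC_natl F n (y : K) : opC F (n%:R * y) = n%:R * opC F y.
Proof.
rewrite /opC fderivM -tofrac_natr fderiv_tofrac -polyC_natr derivC tofrac0.
by rewrite mul0r add0r mulrBr !mulrA ![_ * (n%:R)%:P%:F]mulrC !mulrA.
Qed.

Lemma hirota_tOmegaF_ratfun F (T := tOm F) (S := tOm (downF F)) :
  posset F -> F <> [::] ->
  d (d T%:F) * S%:F - 2%:R * d T%:F * d S%:F + T%:F * d (d S%:F)
  + 2%:R * x * (d T%:F * S%:F - T%:F * d S%:F) = 2%:R * (size F)%:R * T%:F * S%:F.
Proof.
move=> pF Fne; apply: (hirota_ratfun (hirota_tOmegaF C pF Fne)).
by rewrite polyCM !polyC_natr tofracM !tofrac_natr.
Qed.

Lemma tofrac_tOmegaF_neq0 F : (tOm F)%:F != 0 :> K.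
Proof. by rewrite tofrac_eq0 tOmegaF_neq0. Qed.

Lemma opD_down F (y : K) : posset F -> F <> [::] ->
  opD (downF F) y = opE F (opC F y) + 2%:R * ((uF F)%:R - (size F)%:R - 1) * y.
Proof.
move=> pF Fne; have pD := posset_down pF.
have [c c0 cE] := OmegaF_tOmegaF C pD.
(* By [uF_down], the constant |F_down| + u in the operator of F_down is u_F itself. *)
rewrite (@opD_scale _ _ _ (uF F)%:R _ c0 cE); last first.
  by rewrite (uF_down pF pD) natrD addrC.
rewrite /opC /opE -!fderiv_tofrac.
exact: (factor_EC (@fderivD C) (@fderivM C) fderivX (tofrac_tOmegaF_neq0 _)
  (tofrac_tOmegaF_neq0 _) (hirota_tOmegaF_ratfun pF Fne)).
Qed.

Lemma opD_factor F (y : K) : posset F -> F <> [::] ->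
  opD F y = opC F (opE F y) + 2%:R * (uF F)%:R * y.
Proof.
move=> pF Fne; have [c c0 cE] := OmegaF_tOmegaF C pF.
rewrite (opD_scale _ c0 cE (erefl _)) /opC /opE -!fderiv_tofrac.
exact: (factor_CE (@fderivD C) (@fderivM C) (tofrac_tOmegaF_neq0 _)
  (tofrac_tOmegaF_neq0 _) (hirota_tOmegaF_ratfun pF Fne)).
Qed.

End Operators.

(** * Uniqueness of rational eigenfunctions *)

Lemma clear_denom_log (K : fieldType) (a p q x O O1 : K) : q != 0 -> O != 0 ->
  a / (q * q) = 2%:R * (x + O1 / O) * (p / q) -> a * O = 2%:R * (x * O + O1) * p * q.
Proof.
move=> q0 O0 e; have -> : a = 2%:R * (x + O1 / O) * (p / q) * (q * q).
  by rewrite -e; field.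
by field; rewrite q0 O0.
Qed.

Lemma clear_denom_Wronskian (K : fieldType) (p s r p1 s1 r1 : K) : s != 0 ->
  p / s * r1 - (p1 * s - p * s1) / (s * s) * r = 0 -> p1 * (r * s) = p * (r1 * s + r * s1).
Proof.
move=> s0 e; apply/eqP; rewrite eq_sym -subr_eq0; apply/eqP.
transitivity ((p / s * r1 - (p1 * s - p * s1) / (s * s) * r) * (s * s)); first by field.
by rewrite e mul0r.
Qed.

Section Uniqueness.
Variable C : numClosedFieldType.

Local Notation K := {ratfun C}.
Local Notation d := (@fderiv C).
Local Notation x := ('X%:F : K).

(* The solutions [c O ^ 2 exp (x ^ 2)] are not rational. *)
Lemma ratfun_log_deriv_eq0 (O : {poly C}) (w : K) : O != 0 ->
  d w = 2%:R * (x + d O%:F / O%:F) * w -> w = 0.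
Proof.
move=> O0; have [p [q [q0 ->]]] := ratfunP w.
have q0' : q%:F != 0 by rewrite tofrac_eq0.
have O0' : O%:F != 0 by rewrite tofrac_eq0.
rewrite (fderiv_frac _ q0) fderiv_tofrac [_ ^+ 2]expr2 tofracM => /(clear_denom_log q0' O0').
rewrite -[2%:R](tofrac_natr C 2) -!(tofracM, tofracD) => /eqP; rewrite tofrac_eq => /eqP E.
suff /eqP : O * p * q = 0.
  by rewrite !mulf_eq0 (negPf O0) (negPf q0) orbF => /eqP->; rewrite tofrac0 mul0r.
(* Without denominators, 2 X O p q = (p' q - p q') O - 2 O' p q, whose right side has degree at most
   that of O p q. *)
apply: (@mulX_eq0 _ _ ((2%:R^-1)%:P * ((p^`() * q - p * q^`()) * O - 2%:R * O^`() * p * q))).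
  have two : (2%:R^-1)%:P * 2%:R = 1 :> {poly C}.
    by rewrite -polyC_natr -polyCM mulVf ?pnatr_eq0.
  by rewrite E -[LHS]mul1r -[X in X * _ = _]two; ring.
rewrite mul_polyC; apply: leq_trans (size_scale_leq _ _) _.
apply: leq_trans (size_polyD _ _) _; rewrite size_polyN geq_max; apply/andP; split.
  rewrite mulrBl; apply: leq_trans (size_polyD _ _) _; rewrite size_polyN geq_max.
  apply/andP; split.
    have [-> ->] : p^`() * q * O = p^`() * (q * O) /\ O * p * q = p * (q * O).
      by split; ring.
    exact: size_deriv_mul.
  have [-> ->] : p * q^`() * O = q^`() * (p * O) /\ O * p * q = q * (p * O).
    by split; ring.
  exact: size_deriv_mul.
rewrite -!mulrA -polyC_natr mul_polyC (leq_trans (size_scale_leq _ _)) //.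
exact: size_deriv_mul.
Qed.

(** By Abel's formula the Wronskian of the two eigenfunctions satisfies the equation of
    [ratfun_log_deriv_eq0], hence is zero. *)
Lemma opD_eigen_uniq F (l : K) (P S r : {poly C}) : posset F ->
  S != 0 -> r != 0 -> P != 0 ->
  opD F (P%:F / S%:F) = l * (P%:F / S%:F) -> opD F r%:F = l * r%:F ->
  lead_coef (r * S) *: P = lead_coef P *: (r * S).
Proof.
move=> pF S0 r0 P0; have O0 := OmegaF_neq0 C pF.
have OE : OmegaF C F = 1 *: OmegaF C F by rewrite scale1r.
have S0' : S%:F != 0 by rewrite tofrac_eq0.
rewrite !(opD_scale _ (oner_neq0 _) OE (erefl _)) => e1 e2.
have := eigen_Wronskian (@fderivD C) (@fderivM C) e1 e2.
move=> /(ratfun_log_deriv_eq0 O0).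
rewrite fderiv_tofrac (fderiv_frac _ S0) [_ ^+ 2]expr2 tofracM tofracB ![(_ * _)%:F]tofracM.
move=> /(clear_denom_Wronskian S0').
rewrite -!(tofracM, tofracD) => /eqP; rewrite tofrac_eq -derivM => /eqP E.
by apply: deriv_prop => //; rewrite mulf_neq0.
Qed.

(** Up to the sign of moving the first row last, this is [hermite_hirota] with N = n - u_F;
    [eigen_hirota] then gives the eigenvalue 2(u_F + N) = 2n. *)
Lemma opD_hermiteF F n : posset F -> (uF F <= n)%N -> (n - uF F)%N \notin F ->
  opD F (hermiteF C F n)%:F = 2%:R * n%:R * (hermiteF C F n)%:F.
Proof.
move=> pF le nF; have uF' := posset_uniq pF.
have OE : OmegaF C F = 1 *: OmegaF C F by rewrite scale1r.
rewrite (opD_scale _ (oner_neq0 _) OE (erefl _)); set r := hermiteF C F n.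
have r0 : r%:F != 0 :> K by rewrite tofrac_eq0 wronskian_hermite_neq0 //= nF.
have O0 : (OmegaF C F)%:F != 0 :> K by rewrite tofrac_eq0 OmegaF_neq0.
have perm : perm_eq [seq hermite C i | i <- (n - uF F)%N :: F]
    [seq hermite C i | i <- rcons F (n - uF F)%N].
  by apply: perm_map; rewrite perm_sym perm_rcons.
have [b bE] := wronskian_perm perm.
have h : hirota (2%:R * ((size F)%:R - (n - uF F)%:R)) (OmegaF C F) r.
  have := hirotaZ 1 ((-1) ^+ b) (hermite_hirota C (n - uF F)%N uF').
  by rewrite scale1r -mul_polyC rmorph_sign -bE.
have hk : (2%:R * ((size F)%:R - (n - uF F)%:R))%:P%:F =
    2%:R * ((size F)%:R - (n - uF F)%:R) :> K.
  by rewrite polyCM polyCB !polyC_natr tofracM tofracB !tofrac_natr.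
rewrite (eigen_hirota O0 r0 (hirota_ratfun h hk)); congr (_ * _ * _).
by rewrite (natrB _ le); ring.
Qed.

End Uniqueness.

(** * Leading coefficients on both sides of the formula for C_F *)

Lemma lead_ratio_identity (K : fieldType) (a q w v b p g y1 y2 y3 z : K) :
  g != 0 -> b != 0 -> q != 0 -> w != 0 -> v != 0 -> a != 0 -> y3 != 0 ->
  z * y3 = 2%:R * y1 * y2 ->
  - 2%:R * (g * y1 * p) * (y2 * (a * v)) / (y3 * (q * a * (w * v * b)) * g)
    = - z * p / (w * q * b).
Proof.
move=> g0 b0 q0 w0 v0 a0 y30 e; have -> : z = 2%:R * y1 * y2 / y3 by rewrite -e mulfK.
by field; rewrite g0 b0 q0 w0 v0 a0 y30.
Qed.

Lemma leq_fmax F f : sorted ltn F -> f \in F -> (f <= fmax F)%N.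
Proof.
rewrite /fmax; case: F => // x s /=; elim: s x f => [|y s IH] x f /=.
  by rewrite inE => _ /eqP->.
case/andP=> xy ys; rewrite in_cons => /orP[/eqP->|]; last exact: IH.
exact: leq_trans (ltnW xy) (IH _ _ ys (mem_head _ _)).
Qed.

Section LeadingConstants.
Variable C : numClosedFieldType.

Lemma prod_iota1_sub t : \prod_(j <- iota 1 t) (t.+1%:R - j%:R) = t`!%:R :> C.
Proof.
elim: t => [|t IH]; first by rewrite big_nil.
rewrite /= big_cons factS natrM -IH (iotaDl 1 1) big_map.
congr (_ * _); first by rewrite -natrB.
by apply: eq_bigr => j _; rewrite -[t.+2]add1n !natrD; ring.
Qed.

Lemma vdm_iota1 t : vdm C (iota 1 t) = \prod_(j <- iota 1 t) (j.-1)`!%:R.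
Proof.
elim: t => [|t IH]; first by rewrite big_nil.
have -> : iota 1 t.+1 = rcons (iota 1 t) t.+1.
  by rewrite -{1}(addn1 t) iotaD cats1 /= add1n.
by rewrite vdm_rcons big_rcons /= IH prod_iota1_sub.
Qed.

Lemma prod_map_subn s R n : all (leq s) R -> (s <= n)%N ->
  \prod_(f <- R) ((f - s)%:R - (n - s)%:R) = \prod_(f <- R) (f%:R - n%:R) :> C.
Proof.
move=> sR sn; apply: eq_big_seq => f /(allP sR) sf.
by rewrite !natrB //; ring.
Qed.

Lemma vdm_map_subn s R : all (leq s) R -> vdm C [seq (f - s)%N | f <- R] = vdm C R.
Proof.
elim: R => //= f R IH /andP[sf sR]; rewrite IH // big_map.
by rewrite prod_map_subn.
Qed.

Lemma lead_wr_cons N F :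
  lead_wr C (N :: F) = 2%:R ^+ (N + sumn F) * (\prod_(f <- F) (f%:R - N%:R) * vdm C F).
Proof. by []. Qed.

Lemma lead_wr_rcons G M :
  lead_wr C (rcons G M) = lead_wr C G * 2%:R ^+ M * \prod_(g <- G) (M%:R - g%:R).
Proof. by rewrite /lead_wr vdm_rcons sumn_rcons exprD; ring. Qed.

(** Only the term -2 X T p reaches the top degree. *)
Lemma lead_coef_factor (T p : {poly C}) : T != 0 -> p != 0 ->
  lead_coef (T * p^`() - (T^`() + 2%:R * 'X * T) * p) = - 2%:R * lead_coef T * lead_coef p.
Proof.
move=> T0 p0.
have -> : T * p^`() - (T^`() + 2%:R * 'X * T) * p =
    (- 2%:R) *: (T * p * 'X) + (T * p^`() - T^`() * p).
  by rewrite -mul_polyC polyCN polyC_natr; ring.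
rewrite lead_coefDl ?lead_coefZ ?lead_coefMX ?lead_coefM ?mulrA //.
rewrite size_scale ?oppr_eq0 ?pnatr_eq0 // size_mulX ?mulf_neq0 // ltnS.
apply: leq_trans (size_polyD _ _) _; rewrite size_polyN geq_max size_deriv_mul andbT.
by rewrite mulrC [T * p]mulrC size_deriv_mul.
Qed.

(** Differences among [N] and the elements of [R] survive the common shift by [t + 1] and cancel.
    Factors involving 1, ..., t remain in the denominator, those of the new maximum [M] in the
    numerator; the hypothesis on [e] settles the powers of 2. *)
Lemma lead_coef_ratio t R G M N (F := iota 1 t ++ R) (e : int) :
  all (ltn t.+1) R -> (t < N)%N -> uniq (N :: F) -> uniq G ->
  2%:R ^ e * 2%:R ^+ (N + sumn F) =
    2%:R * 2%:R ^+ M * 2%:R ^+ (N - t.+1 + sumn [seq (f - t.+1)%N | f <- R]) :> C ->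
  - 2%:R * lead_wr C (rcons G M) * lead_wr C ((N - t.+1)%N :: [seq (f - t.+1)%N | f <- R])
    / (lead_wr C (N :: F) * lead_wr C G)
  = - 2%:R ^ e * \prod_(g <- G) (M%:R - g%:R)
    / \prod_(j <- iota 1 t)
        ((j.-1)`!%:R * (j%:R - N%:R) * \prod_(f <- R) (f%:R - j%:R)).
Proof.
move=> ltR tN uNF uG eE; have sR : all (leq t.+1) R.
  by apply: sub_all ltR => f; apply: ltnW.
have := lead_wr_neq0 C uNF.
rewrite lead_wr_rcons !lead_wr_cons vdm_map_subn // big_map prod_map_subn //.
rewrite /F vdm_cat big_cat /= !big_split /= vdm_iota1 => nz.
have g0 := lead_wr_neq0 C uG.
move: nz; rewrite !mulf_eq0 !negb_or.
case/and4P=> y0 /andP[q0 a0] /andP[w0 v0] b0.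
exact: (lead_ratio_identity _ g0 b0 q0 w0 v0 a0 y0 eE).
Qed.

End LeadingConstants.

(** * Transport of eigenfunctions from F_down to F *)

Lemma addr_mul_eq (R : pzRingType) (a b c l : R) : a + c * b = l * b -> a = (l - c) * b.
Proof. by move=> e; rewrite mulrBl -e addrK. Qed.

Section Intertwining.
Variable C : numClosedFieldType.

Local Notation K := {ratfun C}.

(** Since D_F C_F = C_F (E_F C_F) + 2 u_F C_F, the eigenvalue 2(n-k-1) becomes 2(n-k-1) - 2(u_F-k-1)
    + 2 u_F = 2n. *)
Lemma opC_hermiteF_eigen F n (r := hermiteF C (downF F) (n - size F - 1)%N) :
  posset F -> F <> [::] -> (vF F <= n)%N ->
  opD F (opC F r%:F) = 2%:R * n%:R * opC F r%:F.
Proof.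
move=> pF Fne vn; have pD := posset_down pF.
have szI := size_involF pF Fne; rewrite (involF_down pF Fne) size_rcons in szI.
have uD := uF_down pF pD.
have [t [R [FE ltR _ _ DE]]] := posset_decomp pF.
have szE : size F = (t + size R)%N by rewrite FE size_cat size_iota.
have szD : size (downF F) = size R by rewrite DE size_map.
have vE : vF F = (uF F + fmax F).+1 by [].
have ND : (n - size F - 1 - uF (downF F) = n - uF F - t.+1)%N by lia.
have le : (uF (downF F) <= n - size F - 1)%N by lia.
(* As n >= v_F, n - u_F exceeds every element of F; both sides are shifted by [t + 1]. *)
have nD : (n - size F - 1 - uF (downF F))%N \notin downF F.
  rewrite ND DE; apply/mapP => -[f fR].
  have lt : (t.+1 < f)%N := allP ltR _ fR.
  have : (f <= fmax F)%N.
    by apply: leq_fmax; [case: pF | rewrite FE mem_cat fR orbT].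
  lia.
have := opD_hermiteF C pD le nD; rewrite -/r (opD_down _ pF Fne) => E.
have {}E : opE F (opC F r%:F) = (2 * (n - uF F))%:R * r%:F.
  have -> : (2 * (n - uF F))%:R = 2%:R * (n - size F - 1)%:R
      - 2%:R * ((uF F)%:R - (size F)%:R - 1) :> K.
    have e : (n - size F - 1 + size F + 1 = n - uF F + uF F)%N by lia.
    have {}e := congr1 (fun i => i%:R : K) e; rewrite !natrD in e.
    by rewrite natrM (_ : (n - uF F)%:R = (n - size F - 1)%:R + (size F)%:R + 1 - (uF F)%:R);
      [ring | rewrite e addrK].
  exact: addr_mul_eq E.
rewrite (opD_factor _ pF Fne) E opC_natl natrM.
by rewrite -mulrDl -mulrDr -natrD subnK //; lia.
Qed.

End Intertwining.

(** * The explicit constant *)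

Lemma exponent_ratio t r M m N v w :
  M.+1 = (m + (t + r))%N -> (t < N)%N -> (v + t.+1 * r)%N = w ->
  (m%:Z + 'C(t + r + 2 - t.+1, 2)%:Z - 'C(t + r + 1, 2)%:Z - 1
    + (N + ('C(t.+1, 2) + w))%N%:Z = (M.+1 + (N - t.+1 + v))%N%:Z :> int)%R.
Proof.
move=> eM tN <-; have -> : (t + r + 2 - t.+1 = r.+1)%N by lia.
rewrite addn1 bin2D; lia.
Qed.

Lemma prod_sub_nth_rcons (C : numClosedFieldType) G M (G' := rcons G M) :
  \prod_(1 <= j < size G') ((nth 0%N G' (size G').-1)%:R - (nth 0%N G' j.-1)%:R)
    = \prod_(g <- G) (M%:R - g%:R) :> C.
Proof.
rewrite /G' size_rcons big_add1 /= nth_rcons ltnn eqxx [RHS](big_nth 0%N).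
by apply: eq_big_nat => i /andP[_ lt]; rewrite nth_rcons lt.
Qed.

Lemma prod_iota1_cat (C : numClosedFieldType) t R j : all (ltn t.+1) R ->
  \prod_(f <- iota 1 t ++ R | (t.+1 < f)%N) (f%:R - j%:R)
    = \prod_(f <- R) (f%:R - j%:R) :> C.
Proof.
move=> ltR; rewrite big_cat /= big1_seq ?mul1r => [|f]; last by rewrite mem_iota; lia.
rewrite big_seq_cond [RHS]big_seq; apply: eq_bigl => f.
by case: (boolP (f \in R)) => // /(allP ltR).
Qed.

Theorem lemma5p3 (C : numClosedFieldType) (F : seq nat)
    (Fset : posset F) (Fne : F <> [::]) (Fadm : admissible F) :
  let k := size F in
  let s := sF F in
  let u := uF F in
  let G := involF F in
  let m := size G in
  [/\ forall y : {ratfun C},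
        opD (downF F) y = opE F (opC F y) + 2%:R * (u%:R - k%:R - 1) * y,
      forall y : {ratfun C},
        opD F y = opC F (opE F y) + 2%:R * u%:R * y
    & forall n : nat, (vF F <= n)%N ->
        opC F (hermiteF C (downF F) (n - k - 1)%N)%:F =
        ((- 2%:R ^ (m%:Z + 'C(k + 2 - s, 2)%:Z - 'C(k + 1, 2)%:Z - 1)
            * \prod_(1 <= j < m) ((nth 0%N G m.-1)%:R - (nth 0%N G j.-1)%:R)
          / \prod_(1 <= j < s)
              ((j.-1)`!%:R * (j%:R - n%:R + u%:R)
                 * \prod_(f <- F | (s < f)%N) (f%:R - j%:R)))
         *: hermiteF C F n)%:F].
Proof.
move=> k s u G m; split=> [y|y|n vn]; [exact: opD_down | exact: opD_factor |].
rewrite {}/k {}/s {}/u {}/m {}/G; set e := (_ - 1 : int).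
have pD := posset_down Fset.
have szI := size_involF Fset Fne; have uD := uF_down Fset pD.
have GE := involF_down Fset Fne; have uG := posset_uniq (posset_involF (downF F)).
have [t [R [FE ltR sR sE DE]]] := posset_decomp Fset.
have szF : size F = (t + size R)%N by rewrite FE size_cat size_iota.
have szD : size (downF F) = size R by rewrite DE size_map.
have szG : size (involF F) = (size (involF (downF F))).+1 by rewrite GE size_rcons.
have vE : vF F = (uF F + fmax F).+1 by [].
pose N := (n - uF F)%N.
have leF f : f \in F -> (f < N)%N.
  by move=> fF; have := leq_fmax (proj1 Fset) fF; rewrite /N; lia.
have tN : (t < N)%N by rewrite /N; lia.
have uNF : uniq (N :: F).
  rewrite /= (posset_uniq Fset) andbT; apply/negP => /leF; by rewrite ltnn.
have leR f : f \in R -> (t.+1 < f < N)%N.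
  by move=> fR; rewrite leF ?FE ?mem_cat ?fR ?orbT // andbT; apply: (allP ltR).
have ND : (n - size F - 1 - uF (downF F) = N - t.+1)%N by rewrite /N; lia.
have uND : uniq ((N - t.+1)%N :: downF F).
  rewrite /= (posset_uniq pD) andbT DE; apply/mapP => -[f /leR]; lia.
set p := hermiteF C (downF F) _; set r := hermiteF C F n.
set T := tOmegaF C F; set S := tOmegaF C (downF F).
have T0 : T != 0 by apply: tOmegaF_neq0.
have S0 : S != 0 by apply: tOmegaF_neq0.
have pE : p = wronskian [seq hermite C i | i <- (N - t.+1)%N :: downF F].
  by rewrite /p /hermiteF ND.
have p0 : p != 0 by rewrite pE wronskian_hermite_neq0.
have r0 : r != 0 by apply: wronskian_hermite_neq0.
set P := T * p^`() - (T^`() + 2%:R * 'X * T) * p.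
have lP : lead_coef P = - 2%:R * lead_coef T * lead_coef p := lead_coef_factor T0 p0.
have P0 : P != 0.
  by rewrite -lead_coef_eq0 lP !mulf_neq0 ?lead_coef_eq0 ?oppr_eq0 ?pnatr_eq0.
have CE : opC F p%:F = P%:F / S%:F := opC_tofrac F p.
have nF : (n - uF F)%N \notin F by case/andP: uNF.
have eig := opC_hermiteF_eigen C Fset Fne vn; rewrite -/p CE in eig.
have le : (uF F <= n)%N by lia.
(* [P / S] and [r] are eigenfunctions for 2n, so [P] is a multiple of [r * S], with the factor given
   by leading coefficients. *)
have := opD_eigen_uniq Fset S0 r0 P0 eig (opD_hermiteF C Fset le nF).
rewrite lead_coefM => E.
have rS0 : lead_coef r * lead_coef S != 0 by rewrite mulf_neq0 ?lead_coef_eq0.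
have PE : P = ((lead_coef P / (lead_coef r * lead_coef S)) *: r) * S.
  by rewrite -scalerAl mulrC -scalerA -E scalerA mulVf // scale1r.
have S0' : S%:F != 0 by rewrite tofrac_eq0.
rewrite CE PE tofracM (mulfK S0'); congr (_%:F); congr (_ *: _).
rewrite lP !lead_coef_tOmegaF GE pE !lead_coef_wronskian_hermite //.
(* Here j - n + u_F is j - N, and the elements of F above s_F = t + 1 are those of [R]. *)
have denE : \prod_(1 <= j < sF F)
      ((j.-1)`!%:R * (j%:R - n%:R + (uF F)%:R)
         * \prod_(f <- F | (sF F < f)%N) (f%:R - j%:R))
    = \prod_(j <- iota 1 t)
        ((j.-1)`!%:R * (j%:R - N%:R) * \prod_(f <- R) (f%:R - j%:R)) :> C.
  rewrite sE /index_iota subn1; apply: eq_bigr => j _.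
  have -> : j%:R - N%:R = j%:R - n%:R + (uF F)%:R :> C.
    by rewrite /N (natrB _ le); ring.
  by rewrite [in \prod_(f <- _ | _) _]FE prod_iota1_cat.
rewrite prod_sub_nth_rcons denE -/N.
have := @lead_coef_ratio C t R (involF (downF F)) (fmax F) N e ltR tN.
rewrite -FE -DE; apply=> //.
have two0 : 2%:R != 0 :> C by rewrite pnatr_eq0.
(* [e] can be negative, so the powers of 2 become integer powers and only exponents are compared. *)
rewrite -exprS -exprD !exprnP -!expfzDr //; congr (_ ^ _).
rewrite /e sE szF [in sumn F]FE sumn_cat sumn_iota1; apply: exponent_ratio => //.
  by rewrite -szF.
by rewrite DE; apply: sumn_map_subn; apply: sub_all ltR => f; apply: ltnW.
Qed.
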